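(* Let $X$ be a real Banach lattice equipped with a sufficiently rich topology $\tau$. (1) If $K\subseteq X_+$ is $\tau$-compact and $\overline{\operatorname{ch}(K)}^\tau$ is $\tau$-compact, then $\operatorname{oep}\big(\overline{\operatorname{sch}(K)}^\tau\big)\subseteq K$. (2) If $K\subseteq X_+$ is weakly compact, then $\operatorname{oep}(\overline{\operatorname{sch}}(K))\subseteq K$. (3) If $K\subseteq X$ is norm compact, then $\operatorname{oep}(\overline{\operatorname{sch}}(K))\subseteq |K|$, where $|K|=\{|x|:x\in K\}$.
   Context: A locally convex Hausdorff topology $\tau$ on a Banach lattice $X$ is called sufficiently rich if (i) the space $X^\tau$ of $\tau$-continuous linear functionals on $X$ is a Banach lattice (with lattice operations given by the Riesz–Kantorovich formulas), and (ii) $X_+$ is $\tau$-closed. $\operatorname{ch}(S)$ is the convex hull; a set $C$ is solid if $x\in X$, $z\in C$, $|x|\le|z|$ imply $x\in C$; $\operatorname{sch}(S)$ is the smallest convex solid set containing $S$; $\overline{\,\cdot\,}^\tau$ denotes $\tau$-closure and $\overline{\operatorname{sch}}(S)$ the norm (equivalently weak) closure of $\operatorname{sch}(S)$. $\operatorname{oep}(A)$ is the set of order extreme points of $A$: $a\in A$ with the property that for all $x_0,x_1\in A$ and $t\in(0,1)$, $a\le(1-t)x_0+tx_1$ implies $x_0=a=x_1$. *)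

(* Defs.v *)
From HB Require Import structures.
From mathcomp Require Import all_boot all_order all_algebra.
From mathcomp Require Import all_classical all_reals all_analysis.
Set Implicit Arguments. Unset Strict Implicit. Unset Printing Implicit Defensive.
Import Order.TTheory GRing.Theory Num.Theory.
Import numFieldNormedType.Exports.
Local Open Scope classical_set_scope.
Local Open Scope ring_scope.

Section BanachLattice.
Variables (R : realType) (V : completeNormedModType R).
Variable le : V -> V -> Prop.

Definition is_lub2 (x y z : V) : Prop :=
  le x z /\ le y z /\ forall w, le x w -> le y w -> le z w.

Definition riesz_space : Prop :=
  [/\ (forall x, le x x) /\
      (forall x y, le x y -> le y x -> x = y) /\
      (forall x y z, le x y -> le y z -> le x z),
      (forall x y z, le x y -> le (x + z) (y + z)),
      (forall (a : R) x y, 0 <= a -> le x y -> le (a *: x) (a *: y))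
    & (forall x y, exists z, is_lub2 x y z)].

Definition vsup (x y : V) : V := xget 0 [set z | is_lub2 x y z].
Definition vabs (x : V) : V := vsup x (- x).

Definition banach_lattice : Prop :=
  riesz_space /\ (forall x y, le (vabs x) (vabs y) -> `|x| <= `|y|).

Definition pos_cone : set V := [set x | le 0 x].

Definition convex_set (C : set V) : Prop :=
  forall x y (t : R), C x -> C y -> 0 <= t -> t <= 1 ->
    C ((1 - t) *: x + t *: y).

Definition solid (C : set V) : Prop :=
  forall x z, C z -> le (vabs x) (vabs z) -> C x.

Definition conv_hull (S : set V) : set V :=
  [set x | forall C, convex_set C -> S `<=` C -> C x].

Definition sch (S : set V) : set V :=
  [set x | forall C, convex_set C -> solid C -> S `<=` C -> C x].

Definition abs_set (K : set V) : set V := [set vabs x | x in K].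

Definition oep (A : set V) : set V :=
  [set a | A a /\ forall x0 x1 (t : R), A x0 -> A x1 -> 0 < t -> t < 1 ->
     le a ((1 - t) *: x0 + t *: x1) -> x0 = a /\ x1 = a].

Definition is_topology (op : set (set V)) : Prop :=
  [/\ op setT,
      (forall F : set (set V), F `<=` op -> op (\bigcup_(U in F) U))
    & (forall U W, op U -> op W -> op (U `&` W))].

Definition top_closure (op : set (set V)) (A : set V) : set V :=
  [set x | forall U, op U -> U x -> U `&` A !=set0].

Definition top_closed (op : set (set V)) (A : set V) : Prop :=
  op (~` A).

Definition top_compact (op : set (set V)) (K : set V) : Prop :=
  forall (I : Type) (U : I -> set V), (forall i, op (U i)) ->
    K `<=` \bigcup_i U i ->
    exists n (g : 'I_n -> I), K `<=` \bigcup_j U (g j).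

Definition lc_hausdorff_topology (tau : set (set V)) : Prop :=
  [/\ is_topology tau,
      (forall x y U, tau U -> U (x + y) ->
         exists A B, [/\ tau A, tau B, A x, B y &
                     forall a b, A a -> B b -> U (a + b)]),
      (forall (c : R) x U, tau U -> U (c *: x) ->
         exists (d : R) B, [/\ 0 < d, tau B, B x &
            forall (c' : R) y, `|c' - c| < d -> B y -> U (c' *: y)]),
      (forall x y, x <> y -> exists A B,
         [/\ tau A, tau B, A x, B y & A `&` B = set0])
    &
      (forall x U, tau U -> U x -> exists W,
         [/\ tau W, convex_set W, W x & W `<=` U])].

Definition lin_functional (f : V -> R) : Prop :=
  forall (a : R) x y, f (a *: x + y) = a * f x + f y.

Definition tau_dual (tau : set (set V)) (f : V -> R) : Prop :=
  lin_functional f /\ forall U : set R, open U -> tau (f @^-1` U).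

Definition rk_set (f g : V -> R) (x : V) : set R :=
  [set f y + g (x - y) | y in [set y | le 0 y /\ le y x]].

Definition is_rk_sup (f g h : V -> R) : Prop :=
  forall x, le 0 x -> has_sup (rk_set f g x) /\ h x = sup (rk_set f g x).

(* |f| <= |g| in the order of X^tau, |f| = f \/ (-f) given by the RK formula *)
Definition rk_abs_le (f g : V -> R) : Prop :=
  forall x, le 0 x -> sup (rk_set f (fun z => - f z) x)
                      <= sup (rk_set g (fun z => - g z) x).

(* (i): X^tau is a Banach lattice with the Riesz--Kantorovich operations:
   it is closed under the RK supremum, and carries a complete lattice norm *)
Definition dual_banach_lattice (tau : set (set V)) : Prop :=
  (forall f g, tau_dual tau f -> tau_dual tau g ->
     exists h, tau_dual tau h /\ is_rk_sup f g h) /\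
  exists N : (V -> R) -> R,
  [/\ (forall f, tau_dual tau f -> 0 <= N f) /\
      (forall f, tau_dual tau f -> N f = 0 -> f = (fun=> 0)),
      (forall (a : R) f, tau_dual tau f -> N (fun x => a * f x) = `|a| * N f),
      (forall f g, tau_dual tau f -> tau_dual tau g ->
          N (fun x => f x + g x) <= N f + N g),
      (forall f g, tau_dual tau f -> tau_dual tau g -> rk_abs_le f g ->
          N f <= N g)
    &
      (forall u : nat -> V -> R, (forall n, tau_dual tau (u n)) ->
         (forall e : R, 0 < e -> exists M, forall m n, (M <= m)%N -> (M <= n)%N ->
             N (fun x => u m x - u n x) < e) ->
         exists f, tau_dual tau f /\
           forall e : R, 0 < e -> exists M, forall n, (M <= n)%N ->
             N (fun x => u n x - f x) < e)].

Definition sufficiently_rich (tau : set (set V)) : Prop :=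
  [/\ lc_hausdorff_topology tau, dual_banach_lattice tau
    & top_closed tau pos_cone].

Definition weak_open (A : set V) : Prop :=
  forall x, A x -> exists n (fs : 'I_n -> V -> R) (e : R),
    [/\ 0 < e, (forall i, lin_functional (fs i) /\ continuous (fs i))
      & [set y | forall i, `|fs i y - fs i x| < e] `<=` A].

Definition weakly_compact (K : set V) : Prop := top_compact weak_open K.

End BanachLattice.

(* Main.v *)
Require Import Defs.
From HB Require Import structures.
From mathcomp Require Import all_boot all_order all_algebra.
From mathcomp Require Import all_classical all_reals all_analysis.
From mathcomp Require Import ring lra.
Set Implicit Arguments. Unset Strict Implicit. Unset Printing Implicit Defensive.
Import Order.TTheory GRing.Theory Num.Theory.
Import numFieldNormedType.Exports.
Local Open Scope classical_set_scope.
Local Open Scope ring_scope.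

(* Let [a] be order extreme in the closure [D] of [sch K], with [K] positive. Elements of [sch K] are dominated by elements of [conv_hull K], so a convergent ultrafilter on [conv_hull K] gives [y] in [D] with [a <= y], whence [a = y]. Thus [a] is an extreme point of the closed convex hull of [K], and Milman's converse to the Krein-Milman theorem puts it in [K].

For the weak topology the convergence of ultrafilters on [conv_hull K] is the Krein-Smulian theorem. An ultrafilter on [conv_hull K] yields a finitely additive mean [I] on bounded functions on [K]. If [I] is not an evaluation on the dual, a minimax argument gives many functionals [f] of norm at most 1 with [f < I f - e] on any prescribed finite set, while [f >= I f - e / 2] on a subset of [K] whose mean is bounded below. Choosing functionals [f k] and points [x k] of [K] alternately, a weak cluster point [p] of the [x k] satisfies [f k p >= I (f k) - e / 2] for all [k], which contradicts [p] being in the norm closed convex hull of the [x k].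

The norm compact case reduces to the weakly compact one, since [vabs] is norm continuous and [K] and [abs_set K] have the same solid convex hull. *)

(** * Hahn-Banach theorem for sublinear relations *)

Section HahnBanach.
Variables (R : realType) (W : lmodType R).
Implicit Types (P Q : W -> R -> Prop) (u v w : W) (a b c d : R).

(* [P v c] is to be read as "every admissible functional is at most [c] at [v]": it is the epigraph of a finite sublinear functional. *)
Definition sublinear_rel P : Prop :=
  [/\ forall u v c d, P u c -> P v d -> P (u + v) (c + d),
      forall a v c, 0 <= a -> P v c -> P (a *: v) (a * c),
      forall c, P 0 c -> 0 <= c
    & forall v, exists c, P v c].

Lemma sublinear_rel00 P : sublinear_rel P -> P 0 0.
Proof.
move=> [_ Pz _ /(_ 0)[c Pc]].
by have := Pz 0 0 c (lexx _) Pc; rewrite scale0r mul0r.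
Qed.

(** A relation maximal under inclusion is the epigraph of a minimal sublinear functional. Its value
    [c] at [w] is an infimum, and adding the bound [- c] at [- w] keeps it sublinear, so by
    maximality that bound was already present. *)
Lemma sublinear_rel_opp P v : sublinear_rel P ->
  (forall Q, sublinear_rel Q -> (forall u c, P u c -> Q u c) ->
     forall u c, Q u c -> P u c) ->
  exists c, P v c /\ P (- v) (- c).
Proof.
move=> sP; have P00 := sublinear_rel00 sP.
case: (sP) => Pd Pz P0 Pt maxP.
suff key w : exists c, [/\ P (- w) (- c), forall d, P w d -> c <= d
    & forall b, (forall d, P w d -> b <= d) -> b <= c].
  have [c1 [Pc1 m1 g1]] := key v; have [c2 [Pc2 m2 g2]] := key (- v).
  rewrite opprK in Pc2; have c12 := m1 _ Pc2.
  exists (- c2); split => //; suff <- : c1 = - c2 by [].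
  apply/le_anti; rewrite c12 /=; apply: g1 => d Pvd.
  rewrite lerNl; apply: g2 => e Pve.
  by have := Pd _ _ _ _ Pvd Pve; rewrite subrr => /P0; lra.
have [d0 Pd0] := Pt (- w).
have hi : has_inf [set d | P w d].
  split; first by have [d Pwd] := Pt w; exists d.
  by exists (- d0) => d /= Pwd; have := P0 _ (eq_ind _ (P ^~ _) (Pd _ _ _ _ Pd0 Pwd) _ (addNr w)); lra.
pose c := inf [set d | P w d].
have cmin d : P w d -> c <= d by move=> Pwd; apply: ge_inf => //; exact: hi.2.
exists c; split => //; last first.
  by move=> b bP; apply: lb_le_inf => //; exact: hi.1.
(* This is the closure of [P] and the pair [(- w, - c)] under sums and nonnegative multiples.
   [Q 0 d] still forces [0 <= d] because [c] is below every bound at [w]. *)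
pose Q u d := exists2 t, 0 <= t & P (u + t *: w) (d + t * c).
apply: (maxP Q).
- split.
  + move=> u v' d e [s s0 Ps] [t t0 Pt']; exists (s + t); first exact: addr_ge0.
    rewrite scalerDl mulrDl addrACA [d + e + _]addrACA; exact: Pd.
  + move=> a u d a0 [s s0 Ps]; exists (a * s); first exact: mulr_ge0.
    by rewrite -scalerA -mulrA -scalerDr -mulrDr; exact: Pz.
  + move=> d [t]; rewrite le_eqVlt => /predU1P[<-|t0].
      by rewrite scale0r mul0r !addr0; exact: P0.
    rewrite add0r => Pt'.
    have := Pz t^-1 _ _ _ Pt'; rewrite invr_ge0 (ltW t0) => /(_ isT).
    rewrite scalerA mulVf ?gt_eqF// scale1r => /cmin.
    by rewrite mulrDr mulrA mulVf ?gt_eqF// mul1r lerDr pmulr_rge0 ?invr_gt0.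
  + by move=> u; have [d Pud] := Pt u; exists d, 0; rewrite // scale0r mul0r !addr0.
- by move=> u d Pud; exists 0; rewrite // scale0r mul0r !addr0.
- by exists 1; rewrite // scale1r mul1r !addNr.
Qed.

(** Zorn's lemma extends [P] to a maximal sublinear relation. By [sublinear_rel_opp] it contains
    opposite bounds at [v] and [- v], which pins down the value [l v] and makes [l] linear. *)
Lemma Hahn_Banach_rel P : sublinear_rel P ->
  exists l : W -> R, (forall a u v, l (a *: u + v) = a * l u + l v) /\
    forall v c, P v c -> l v <= c.
Proof.
move=> sP.
pose QQ := [set A : set (W * R) | A = set0 \/
  ((forall v c, P v c -> A (v, c)) /\ sublinear_rel (fun v c => A (v, c)))].
have [A [QA maxA]] : exists A, QQ A /\ forall B, A `<` B -> ~ QQ B.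
  apply: Zorn_bigcup => F FQ Ftot.
  have [->|/set0P[[v0 c0] [X0 FX0 X0v]]] := eqVneq (\bigcup_(X in F) X) set0.
    by left.
  have good X p : F X -> X p -> (forall v c, P v c -> X (v, c)) /\
      sublinear_rel (fun v c => X (v, c)).
    by move=> FX Xp; have [X_0|//] := FQ _ FX; rewrite X_0 in Xp.
  right; split.
    by move=> v c Pvc; exists X0 => //; apply: (good _ _ FX0 X0v).1.
  split.
  - move=> u v c d [X FX Xu] [Y FY Yv].
    have [XY|YX] := Ftot _ _ FX FY.
      exists Y => //; have [_ [H _ _ _]] := good _ _ FY Yv; apply: H => //.
      exact: XY.
    exists X => //; have [_ [H _ _ _]] := good _ _ FX Xu; apply: H => //.
    exact: YX.
  - move=> a v c a0 [X FX Xv]; exists X => //.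
    by have [_ [_ H _ _]] := good _ _ FX Xv; exact: H.
  - by move=> c [X FX Xv]; have [_ [_ _ H _]] := good _ _ FX Xv; exact: H.
  - case: sP => _ _ _ Pt v; have [c Pvc] := Pt v; exists c, X0 => //.
    exact: (good _ _ FX0 X0v).1.
have {QA}[PA sA] : (forall v c, P v c -> A (v, c)) /\
    sublinear_rel (fun v c => A (v, c)).
  case: QA => // A0; case: (maxA [set p | P p.1 p.2]).
    rewrite A0 properEneq; split; last exact: sub0set.
    have P00 := sublinear_rel00 sP.
    by apply/eqP => /seteqP[_ /(_ (0, 0) P00)].
  by right; split.
have opp v : exists c, A (v, c) /\ A (- v, - c).
  apply: (@sublinear_rel_opp (fun v c => A (v, c))) => // Q sQ AQ u c Quc.
  apply: contrapT => nA; apply: (maxA [set p | Q p.1 p.2]).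
    split; first by move=> [? ?] /AQ.
    by move=> /(_ (u, c)) /(_ Quc).
  by right; split => // ? ? /PA /AQ.
have [l lP] := choice opp.
case: sA => Ad Az A0 _.
have le_l v c : A (v, c) -> l v <= c.
  move=> Avc; have := Ad _ _ _ _ Avc (lP v).2.
  by rewrite subrr => /A0; rewrite subr_ge0.
exists l; split; last by move=> v c /PA; exact: le_l.
move=> a u v.
have sub b w : A (b *: w, b * l w).
  have [b0|b0] := leP 0 b; first by apply: Az => //; exact: (lP w).1.
  rewrite -[b]opprK scaleNr -scalerN mulNr -mulrN.
  by apply: Az; rewrite ?oppr_ge0 ?ltW//; exact: (lP w).2.
apply/le_anti/andP; split.
  by apply: le_l; apply: Ad => //; exact: (lP v).1.
have := Ad _ _ _ _ (lP (a *: u + v)).1 (Ad _ _ _ _ (sub (- a) u) (lP v).2).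
by rewrite scaleNr -opprD subrr => /A0; lra.
Qed.

End HahnBanach.

(** * Linear functionals and their norm bounds *)

Section LinearFunctionals.
Variables (R : realType) (V : completeNormedModType R).
Implicit Types (f g : V -> R).

(** The one-sided bound, applied at [- x], also controls the absolute value. [N] is any bound, not
    the exact operator norm. *)
Definition bounded_functional f (N : R) := lin_functional f /\ forall x, f x <= N * `|x|.

Section lin_functional.
Variables (f : V -> R) (lf : lin_functional f).

Lemma lin_functional0 : f 0 = 0.
Proof. by have := lf 1 0 0; rewrite scaler0 addr0 mul1r; lra. Qed.

Lemma lin_functionalZ a x : f (a *: x) = a * f x.
Proof. by rewrite -[a *: x]addr0 lf lin_functional0 addr0. Qed.

Lemma lin_functionalD x y : f (x + y) = f x + f y.
Proof. by rewrite -[x in LHS]scale1r lf mul1r. Qed.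

Lemma lin_functionalN x : f (- x) = - f x.
Proof. by rewrite -scaleN1r lin_functionalZ mulN1r. Qed.

Lemma lin_functionalB x y : f (x - y) = f x - f y.
Proof. by rewrite lin_functionalD lin_functionalN. Qed.

Lemma lin_functional_sum m (l : 'I_m -> R) (s : 'I_m -> V) :
  f (\sum_i l i *: s i) = \sum_i l i * f (s i).
Proof.
elim/big_rec2: _ => [|i y1 y2 _ <-]; first exact: lin_functional0.
by rewrite lin_functionalD lin_functionalZ.
Qed.

End lin_functional.

Lemma bounded_functional_abs f N x : bounded_functional f N -> `|f x| <= N * `|x|.
Proof.
move=> [lf fN]; rewrite ler_norml fN andbT.
by have := fN (- x); rewrite normrN lin_functionalN//; lra.
Qed.

Lemma bounded_functionalN f N : bounded_functional f N ->
  bounded_functional (fun x => - f x) N.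
Proof.
move=> [lf fN]; split; first by move=> a x y; rewrite lf; ring.
by move=> x; rewrite -lin_functionalN// -[`|x|]normrN.
Qed.

Lemma bounded_functional0 : bounded_functional (fun=> 0) 0.
Proof. by split=> [a x y|x]; rewrite ?mulr0 ?mul0r ?addr0. Qed.

Lemma bounded_functionalZ a f N : 0 <= a -> bounded_functional f N ->
  bounded_functional (fun x => a * f x) (a * N).
Proof.
move=> a0 [lf fN]; split; first by move=> b x y; rewrite lf; ring.
by move=> x; rewrite -mulrA ler_wpM2l.
Qed.

Lemma bounded_functionalD f g N M : bounded_functional f N ->
  bounded_functional g M -> bounded_functional (fun x => f x + g x) (N + M).
Proof.
move=> [lf fN] [lg gM]; split; first by move=> b x y; rewrite lf lg; ring.
by move=> x; rewrite mulrDl lerD.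
Qed.

Lemma bounded_functional_continuous f N : bounded_functional f N -> continuous f.
Proof.
move=> fN x; apply/cvgrPdist_lt => e e0.
have d0 : 0 < e / (`|N| + 1) by rewrite divr_gt0// ltr_wpDl.
near=> y; have xy : `|x - y| < e / (`|N| + 1).
  by near: y; apply: cvgr_dist_lt => //; exact: cvg_id.
rewrite -lin_functionalB; last exact: fN.1.
apply: le_lt_trans (bounded_functional_abs (x - y) fN) _.
move: xy; rewrite ltr_pdivlMr ?ltr_wpDl// => xy.
have N1 : N <= `|N| by rewrite ler_norm.
have xy0 : 0 <= `|x - y| by [].
nra.
Unshelve. all: by end_near. Qed.

Lemma continuous_bounded_functional f : lin_functional f -> continuous f ->
  exists N, bounded_functional f N.
Proof.
move=> lf cf.
have /cvgrPdist_lt /(_ 1 ltr01) := cf 0.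
rewrite lin_functional0// => /nbhs_normP [d /= d0 df].
exists (2 / d); split => // x.
have [->|x0] := eqVneq x 0; first by rewrite lin_functional0// normr0 mulr0.
have nx : 0 < `|x| by rewrite normr_gt0.
have := df ((d / 2 / `|x|) *: x) => /=; rewrite !sub0r !normrN (lin_functionalZ lf) normrZ normrM normfV.
rewrite normr_id mulfVK ?gt_eqF// gtr0_norm ?divr_gt0// => H.
have /H : d / 2 < d by lra.
rewrite normrM (@gtr0_norm _ (d / 2 / `|x|)) ?divr_gt0// mulrAC ltr_pdivrMr// mul1r => {}H.
have := ler_norm (f x).
rewrite mulrAC ler_pdivlMr// => ?; nra.
Qed.

End LinearFunctionals.

(** * Separation of convex sets and uniform boundedness *)

Section Separation.
Variables (R : realType) (V : completeNormedModType R).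
Implicit Types (C : set V) (x y : V) (r s t : R).

(** This merges two weighted points of [C] into one; when the total weight vanishes, any point of
    [C] serves. *)
Lemma convex_set_weights C x y s t : Defs.convex_set C -> C x -> C y ->
  0 <= s -> 0 <= t -> exists2 z, C z & s *: x + t *: y = (s + t) *: z.
Proof.
move=> cC Cx Cy s0 t0; have [st0|st0] := eqVneq (s + t) 0.
  have s_0 : s = 0 by lra.
  have t_0 : t = 0 by lra.
  by exists x; rewrite // s_0 t_0 !scale0r !addr0 scale0r.
have stp : 0 < s + t by rewrite lt_neqAle eq_sym st0 addr_ge0.
exists ((1 - t / (s + t)) *: x + (t / (s + t)) *: y).
  apply: cC => //; first by rewrite divr_ge0// ltW.
  by rewrite ler_pdivrMr// mul1r lerDr.
have e1 : (s + t) * (1 - t / (s + t)) = s by field.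
have e2 : (s + t) * (t / (s + t)) = t by field.
by rewrite scalerDr !scalerA e1 e2.
Qed.

(** Hahn-Banach is applied to the infimum of [|v + t (x - y)| - t r] over [t >= 0] and [y] in [C],
    which the distance hypothesis keeps nonnegative at 0. The choice [t = 0] bounds [f] by the norm;
    [t = 1] at [y - x] gives the gap [r]. *)
Lemma convex_separation C x r : Defs.convex_set C -> C !=set0 ->
  (forall y, C y -> r <= `|x - y|) ->
  exists f, bounded_functional f 1 /\ forall y, C y -> f y + r <= f x.
Proof.
move=> convC [y0 Cy0] rC.
pose P (v : V) (c : R) := exists (t : R) y, [/\ 0 <= t, C y & `|v + t *: (x - y)| <= c + t * r].
have [|f [lf fP]] := @Hahn_Banach_rel R V P.
  split.
  - move=> u v c d [s [y [s0 Cy sP]]] [t [z [t0 Cz tP]]].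
    have [w Cw ew] := convex_set_weights convC Cy Cz s0 t0.
    exists (s + t), w; split => //; first exact: addr_ge0.
    have -> : u + v + (s + t) *: (x - w) = (u + s *: (x - y)) + (v + t *: (x - z)).
      rewrite scalerBr -ew !scalerBr scalerDl opprD.
      by rewrite (addrACA (s *: x)) [LHS]addrACA.
    by rewrite (le_trans (ler_normD _ _))// mulrDl addrACA lerD.
  - move=> a v c a0 [t [y [t0 Cy tP]]]; exists (a * t), y; split => //.
      exact: mulr_ge0.
    by rewrite -scalerA -scalerDr normrZ ger0_norm// -mulrA -mulrDr ler_wpM2l.
  - move=> c [t [y [t0 Cy]]]; rewrite add0r normrZ ger0_norm// => tP.
    by have := ler_wpM2l t0 (rC _ Cy); lra.
  - by move=> v; exists `|v|, 0, y0; rewrite scale0r mul0r !addr0.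
exists f; split.
  split => // v; apply: fP; exists 0, y0.
  by rewrite scale0r !mul0r mul1r !addr0.
move=> y Cy; have /fP : P (y - x) (- r).
  by exists 1, y; split; rewrite // scale1r mul1r subrKA subrr normr0 addNr.
by rewrite lin_functionalB//; lra.
Qed.

Lemma norming_functional x : exists f, bounded_functional f 1 /\ f x = `|x|.
Proof.
have [|||f [bf fx]] := @convex_separation [set 0] x `|x|.
- by move=> y z t -> -> _ _; rewrite /= !scaler0 addr0.
- by exists 0.
- by move=> y ->; rewrite subr0.
exists f; split => //; apply/le_anti.
have := fx 0 erefl; rewrite lin_functional0 ?add0r; last exact: bf.1.
by move=> ->; have := bf.2 x; rewrite mul1r => ->.
Qed.

End Separation.

Section Ultrafilters.
Variable R : realType.

Lemma fmap_ultra (S T : Type) (f : S -> T) (G : set_system S) :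
  UltraFilter G -> UltraFilter (f @ G).
Proof.
move=> GU; split=> [|H HF sGH].
  exact: fmap_proper_filter.
apply/seteqP; split=> A; last exact: sGH.
move=> HA; have [//|GnA] := in_ultra_setVsetC (f @^-1` A) GU.
have /sGH HnA : (f @ G) (~` A) by [].
by have /filter_ex [? []] : H (A `&` ~` A) by exact: filterI.
Qed.

(** Compactness of the segment [[- M, M]] gives the limit. Such limits later define functionals and
    means pointwise. *)
Lemma ultra_bounded_cvg (T : Type) (G : set_system T) (u : T -> R) (M : R) :
  UltraFilter G -> G [set t | `|u t| <= M] -> cvg (u @ G).
Proof.
move=> GU GM.
have := @segment_compact R (- M) M; rewrite compact_ultra => cpt.
have [|l [_ ul]] := cpt (u @ G) (fmap_ultra u GU).
  have sub : [set t | `|u t| <= M] `<=` u @^-1` `[- M, M].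
    by move=> t /=; rewrite in_itv /= ler_norml.
  exact: (filterS sub GM).
by apply/cvg_ex; exists l.
Qed.

End Ultrafilters.

(** * Uniform boundedness by a gliding hump *)

Section GlidingHump.
Variables (R : realType) (V : completeNormedModType R).

(** The functional is a signed series of norming functionals of the [x k] with weights [3 ^- k],
    each sign chosen so as not to cancel the previous partial sum at [x k]. The tail after step [k]
    costs at most half of what that step secures at [x k]. *)
Lemma gliding_hump_functional (x : nat -> V) : exists (f : V -> R) N,
  bounded_functional f N /\ forall k, `|x k| <= 2 * 3 ^+ k * `|f (x k)|.
Proof.
have [n nP] := choice (fun k => norming_functional (x k)).
pose r (k : nat) : R := (3 ^+ k)^-1.
have r0 k : 0 < r k by rewrite /r invr_gt0 exprn_gt0.
have rS k : r k.+1 = r k / 3 by rewrite /r exprS invfM mulrC.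
pose F := fix F k : V -> R := if k is k'.+1 then
  fun v => F k' v + (if 0 <= F k' (x k') then r k' else - r k') * n k' v
  else fun=> 0.
have lF k : lin_functional (F k).
  elim: k => [|k IH] a u v /=; first by rewrite mulr0 addr0.
  by rewrite IH (nP k).1.1; ring.
have FS k v : `|F k.+1 v - F k v| <= r k * `|v|.
  rewrite /= addrC addKr normrM.
  have := bounded_functional_abs v (nP k).1; rewrite mul1r.
  by case: ifP => _; rewrite ?normrN (gtr0_norm (r0 k)) => ?; rewrite ler_pM2l.
(* The factor is the exact geometric sum of [r i] for [k <= i < j + k]. *)
have Fd k j v : `|F (j + k)%N v - F k v| <= 3 / 2 * (r k - r (j + k)%N) * `|v|.
  elim: j => [|j IH]; first by rewrite add0n !subrr normr0 mulr0 mul0r.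
  rewrite addSn rS -[F _.+1 v](subrK (F (j + k)%N v)) -addrA.
  apply: le_trans (ler_normD _ _) _; have := FS (j + k)%N v.
  by have := r0 (j + k)%N; have := normr_ge0 v; nra.
have Fd' k j v : (k <= j)%N -> `|F j v - F k v| <= 3 / 2 * r k * `|v|.
  move=> kj; have := Fd k (j - k)%N v; rewrite subnK// => /le_trans; apply.
  by apply: ler_wpM2r => //; have := r0 j; nra.
(* The pointwise limit is taken along an ultrafilter, so boundedness alone ensures that it
   exists. *)
have [G [GU sG]] := ultraFilterLemma (F := \oo) _.
have Glarge k : G [set j | (k <= j)%N] by apply: sG; exact: nbhs_infty_ge.
have Fcvg v : cvg (F ^~ v @ G).
  apply: (@ultra_bounded_cvg _ _ _ _ (3 / 2 * r 0%N * `|v|)).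
  by apply: filterS (Glarge 0%N) => j /= j0; have := Fd' 0%N j v j0; rewrite /= subr0.
pose f v := lim (F ^~ v @ G).
have fF k v : `|f v - F k v| <= 3 / 2 * r k * `|v|.
  have c : (fun j => `|F j v - F k v|) @ G --> `|f v - F k v|.
    by apply: cvg_norm; apply: cvgB; [exact: Fcvg|exact: cvg_cst].
  rewrite -(cvg_lim _ c)//; apply: limr_le; first by apply/cvg_ex; eexists; exact: c.
  by apply: filterS (Glarge k) => j; exact: Fd'.
exists f, (3 / 2 * r 0%N); split; first split.
- move=> a u v; apply: cvg_lim => //.
  rewrite (_ : F ^~ _ = fun j => a * F j u + F j v); last first.
    by apply/funext => j; rewrite lF.
  by apply: cvgD; [apply: cvgM; [exact: cvg_cst|]|]; exact: Fcvg.
- by move=> v; have := fF 0%N v; rewrite /= subr0 => /(le_trans (ler_norm _)).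
move=> k; have := fF k.+1 (x k); rewrite rS.
have H : r k * `|x k| <= `|F k.+1 (x k)|.
  rewrite /= (nP k).2; have rx : 0 <= r k * `|x k| by rewrite mulr_ge0// ltW.
  case: ifP => [h|/negbT]; last rewrite -ltNge => h.
    by rewrite ger0_norm; lra.
  by rewrite mulNr ler0_norm; lra.
have := ler_normD (F k.+1 (x k) - f (x k)) (f (x k)); rewrite subrK distrC => H1 H2.
have {H1 H2}H : r k * `|x k| <= 2 * `|f (x k)| by lra.
have -> : `|x k| = 3 ^+ k * (r k * `|x k|).
  by rewrite mulrA /r mulfV ?mul1r// gt_eqF// exprn_gt0.
by rewrite [2 * _]mulrC -mulrA ler_pM2l// exprn_gt0.
Unshelve. all: by apply: eventually_filter.
Qed.

(** Otherwise some [x k] in [K] have norm beyond [2 * 3 ^+ k * k], and the gliding hump functional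
    exceeds [k] in absolute value at [x k]. *)
Lemma weakly_bounded_bounded (K : set V) :
  (forall (f : V -> R) N, bounded_functional f N ->
     exists M, forall x, K x -> `|f x| <= M) ->
  exists M, forall x, K x -> `|x| <= M.
Proof.
move=> wb; apply: contrapT => nb.
have [|x xP] := @choice nat V (fun k y => K y /\ 2 * 3 ^+ k * k%:R < `|y|).
  move=> k.
  apply: contrapT => nx; apply: nb; exists (2 * 3 ^+ k * k%:R) => y Ky.
  by rewrite leNgt; apply/negP => ly; apply: nx; exists y.
have [f [N [bf fx]]] := gliding_hump_functional x.
have [M fM] := wb _ _ bf.
have M0 : 0 <= M by apply: le_trans (fM _ (xP 0%N).1).
have := archi_boundP M0; set k := Num.bound M => Mk.
have := lt_le_trans (xP k).2 (fx k).
by rewrite ltr_pM2l ?mulr_gt0 ?exprn_gt0// ltNge (le_trans (fM _ (xP k).1)) ?ltW.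
Qed.

End GlidingHump.

(** * The weak topology *)

Definition ord_cat (T : Type) n m (f : 'I_n -> T) (g : 'I_m -> T) (i : 'I_(n + m)) : T :=
  match fintype.split i with inl j => f j | inr j => g j end.

Lemma ord_cat_all (T : Type) n m (f : 'I_n -> T) (g : 'I_m -> T) (P : T -> Prop) :
  (forall i, P (ord_cat f g i)) <-> (forall i, P (f i)) /\ (forall i, P (g i)).
Proof.
split=> [H|[Hf Hg] i]; last by rewrite /ord_cat; case: fintype.split.
split=> i; first by have := H (unsplit (inl i)); rewrite /ord_cat unsplitK.
by have := H (unsplit (inr i)); rewrite /ord_cat unsplitK.
Qed.

Lemma ord_forall_bounded (R : realType) n (u : 'I_n -> R) : exists M, forall i, u i <= M.
Proof.
exists (\sum_i `|u i|) => i.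
by rewrite (bigD1 i)//= (le_trans (ler_norm _))// lerDl sumr_ge0.
Qed.

(** * Compactness through ultrafilters *)

Section TopCompact.
Variables (R : realType) (V : completeNormedModType R).
Implicit Types (op : set (set V)) (K : set V).

(** Topologies are bare families of open sets, so that the norm, weak and given topologies coexist
    on [V]. *)
Definition tau_cvg op (G : set_system V) (x : V) := forall U, op U -> U x -> G U.

(** If no point of [K] were a limit, the open sets outside [G] would cover [K]; the complements of a
    finite subcover belong to [G] and have no common point in [K]. *)
Lemma top_compact_ultra op K (G : set_system V) : top_compact op K ->
  UltraFilter G -> G K -> exists2 x, K x & tau_cvg op G x.
Proof.
move=> cK GU GK; apply: contrapT => nx.
pose I := {U : set V | op U /\ ~ G U}.
have [|x Kx|n [g Kg]] := cK I (fun i => sval i); first by move=> [U []].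
  apply: contrapT => nU; apply: nx; exists x => // U opU Ux.
  apply: contrapT => nGU; apply: nU.
  by exists (exist _ U (conj opU nGU)).
have : forall i, G (~` sval (g i)).
  by move=> i; case: (g i) => U [opU nGU] /=; have [|] := in_ultra_setVsetC U GU.
move=> /filter_forall /(filterI GK) /filter_ex[x [/Kg[j _ gx]]].
by move=> /(_ j); exact.
Qed.

(** Without a finite subcover, [K] minus finite unions generates a proper filter. A cluster point
    would lie in some [U i], which the basic set for the single index [i] avoids. *)
Lemma compact_top_compact op K : (forall U, op U -> open U) ->
  compact K -> top_compact op K.
Proof.
move=> opO cK I U opU KU; apply: contrapT => nfin.
pose J := {n : nat & 'I_n -> I}.
pose B (s : J) := K `&` [set x | forall j, ~ U (projT2 s j) x].
have FF : ProperFilter (filter_from [set: J] B).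
  apply: filter_from_proper; last first.
    move=> [n g] _; apply: contrapT => B0; apply: nfin; exists n, g => x Kx.
    apply: contrapT => nU; apply: B0; exists x; split => //= j Ux.
    by apply: nU; exists j.
  apply: filter_from_filter.
    by exists (existT _ 0%N (fun i : 'I_0 => match notF (ltn_ord i) with end)).
  move=> [n f] [m g] _ _; exists (existT _ (n + m)%N (ord_cat f g)) => //.
  by move=> x [Kx] /= /(ord_cat_all f g (fun i => ~ U i x))[].
have [x [Kx clx]] : K `&` cluster (filter_from [set: J] B) !=set0.
  apply: cK; exists (existT _ 0%N (fun i : 'I_0 => match notF (ltn_ord i) with end)) => //.
  by move=> x [].
have [i _ Ux] := KU _ Kx.
have [] := clx (B (existT _ 1%N (fun=> i))) (U i).
- by exists (existT _ 1%N (fun=> i)).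
- by apply: open_nbhs_nbhs; split => //; exact: opO.
by move=> y [[Ky /(_ ord0)]].
Qed.

End TopCompact.

Section WeakTopology.
Variables (R : realType) (V : completeNormedModType R).
Implicit Types (C K U : set V) (f : V -> R).

Lemma weak_open_preimage f N (O : set R) : bounded_functional f N ->
  open O -> weak_open (f @^-1` O).
Proof.
move=> bf oO x Ox.
have /nbhs_normP[e /= e0 eO] : nbhs (f x) O by exact: open_nbhs_nbhs.
exists 1%N, (fun=> f), e; split => // [_|y /(_ ord0) fy].
  by split; [exact: bf.1|exact: bounded_functional_continuous bf].
by apply: eO; rewrite /= distrC.
Qed.

Lemma weak_openT : weak_open [set: V].
Proof.
move=> x _; exists 0%N, (fun _ _ => 0), 1; split => // -[] //.
Qed.

Lemma weak_openI U W : weak_open U -> weak_open W -> weak_open (U `&` W).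
Proof.
move=> oU oW x [Ux Wx].
have [n [fs [d [d0 fsP dU]]]] := oU _ Ux.
have [m [gs [e [e0 gsP eW]]]] := oW _ Wx.
exists (n + m)%N, (ord_cat fs gs), (Num.min d e); split.
- by rewrite lt_min d0.
- by apply/(ord_cat_all fs gs (fun f => lin_functional f /\ continuous f)).
move=> y /= /(ord_cat_all fs gs (fun f => `|f y - f x| < Num.min d e))[yU yW].
split; [apply: dU|apply: eW] => i.
  by have := yU i; rewrite lt_min => /andP[].
by have := yW i; rewrite lt_min => /andP[].
Qed.

Lemma weak_open_topology : is_topology (@weak_open R V).
Proof.
split; [exact: weak_openT| |exact: weak_openI].
move=> F Fop x [U FU Ux]; have [n [fs [d [d0 fsP dU]]]] := Fop _ FU _ Ux.
by exists n, fs, d; split => // y /dU Uy; exists U.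
Qed.

Lemma weak_open_forall n (A : 'I_n -> set V) : (forall i, weak_open (A i)) ->
  weak_open [set x | forall i, A i x].
Proof.
elim: n A => [|n IH] A oA.
  suff -> : [set x | forall i, A i x] = setT by exact: weak_openT.
  by apply/seteqP; split => // x _ [].
suff -> : [set x | forall i, A i x] =
    A ord0 `&` [set x | forall i, A (lift ord0 i) x].
  by apply: weak_openI => //; exact: IH.
apply/seteqP; split=> [x Ax|x [A0 AS] i]; first by split=> [|i]; exact: Ax.
by case: (unliftP ord0 i) => [j|] ->; [exact: AS|].
Qed.

Lemma weak_ball_open n (fs : 'I_n -> V -> R) x (e : R) :
  (forall i, lin_functional (fs i) /\ continuous (fs i)) ->
  weak_open [set y | forall i, `|fs i y - fs i x| < e].
Proof.
move=> fsP; apply: weak_open_forall => i.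
have [lf cf] := fsP i; have [N bf] := continuous_bounded_functional lf cf.
apply: (@weak_open_preimage (fs i) N [set r | `|r - fs i x| < e]) => //.
have -> : [set r | `|r - fs i x| < e] = ball (fs i x) e.
  by apply/seteqP; split=> r; rewrite /= /ball /= distrC.
exact: ball_open.
Qed.

Lemma convex_weak_ball n (fs : 'I_n -> V -> R) x (e : R) :
  (forall i, lin_functional (fs i)) ->
  Defs.convex_set [set y | forall i, `|fs i y - fs i x| < e].
Proof.
move=> fsP y z t yP zP t0 t1 i.
rewrite (lin_functionalD (fsP i)) !(lin_functionalZ (fsP i)).
have := yP i; have := zP i; rewrite !ltr_norml => /andP[z1 z2] /andP[y1 y2].
have [->|tn0] := eqVneq t 0; first by apply/andP; split; lra.
have tp : 0 < t by rewrite lt_neqAle eq_sym tn0.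
have h1 := mulr_ge0 (_ : 0 <= 1 - t) (_ : 0 <= fs i y - fs i x + e).
have h2 := mulr_ge0 (_ : 0 <= 1 - t) (_ : 0 <= e - (fs i y - fs i x)).
have h3 := mulr_gt0 tp (_ : 0 < fs i z - fs i x + e).
have h4 := mulr_gt0 tp (_ : 0 < e - (fs i z - fs i x)).
have {}h1 := h1 ltac:(lra) ltac:(lra).
have {}h2 := h2 ltac:(lra) ltac:(lra).
have {}h3 := h3 ltac:(lra).
have {}h4 := h4 ltac:(lra).
by apply/andP; split; lra.
Qed.

Lemma weak_lc_hausdorff : lc_hausdorff_topology (@weak_open R V).
Proof.
split.
- exact: weak_open_topology.
- move=> x y U oU Uxy; have [n [fs [e [e0 fsP eU]]]] := oU _ Uxy.
  exists [set z | forall i, `|fs i z - fs i x| < e / 2],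
    [set z | forall i, `|fs i z - fs i y| < e / 2].
  split; [exact: weak_ball_open|exact: weak_ball_open| | |].
  + by move=> i /=; rewrite subrr normr0 divr_gt0.
  + by move=> i /=; rewrite subrr normr0 divr_gt0.
  move=> a b aP bP; apply: eU => i; have lf := (fsP i).1.
  rewrite !(lin_functionalD lf) opprD addrACA.
  by apply: le_lt_trans (ler_normD _ _) _; rewrite [e]splitr ltrD.
- move=> c x U oU Ucx; have [n [fs [e [e0 fsP eU]]]] := oU _ Ucx.
  have [M0 MP] := ord_forall_bounded (fun i => `|fs i x|).
  pose M := `|M0| + 1.
  have Mp : 0 < M by have := normr_ge0 M0; rewrite /M; lra.
  (* The bound 1 keeps [fs i y] below [M + 1], so moving [c] costs at most [e / 2]; the second bound
     makes moving [x] cost less than [e / 2]. *)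
  pose b := Num.min 1 (e / 2 / (`|c| + 1)).
  have cp : 0 < `|c| + 1 by have := normr_ge0 c; lra.
  have b0 : 0 < b by rewrite lt_min ltr01 !divr_gt0.
  exists (e / 2 / (M + 1)), [set z | forall i, `|fs i z - fs i x| < b].
  have d0 : 0 < e / 2 / (M + 1) by rewrite !divr_gt0// addr_gt0.
  split => //.
  + exact: weak_ball_open.
  + by move=> i /=; rewrite subrr normr0.
  move=> c' y cc' yP; apply: eU => i.
  rewrite !(lin_functionalZ (fsP i).1).
  have -> : c' * fs i y - c * fs i x = (c' - c) * fs i y + c * (fs i y - fs i x).
    by ring.
  apply: le_lt_trans (ler_normD _ _) _; rewrite !normrM.
  have := yP i; rewrite lt_min => /andP[y1 y2].
  have fyM : `|fs i y| <= M + 1.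
    rewrite -[fs i y](subrK (fs i x)) (le_trans (ler_normD _ _))//.
    by have := MP i; have := ler_norm M0; rewrite /M; lra.
  have h1 : `|c' - c| * `|fs i y| <= e / 2 / (M + 1) * (M + 1).
    by rewrite ler_pM// ltW.
  have h2 : `|c| * `|fs i y - fs i x| < e / 2.
    apply: (@le_lt_trans _ _ (`|c| * (e / 2 / (`|c| + 1)))).
      by rewrite ler_wpM2l// ltW.
    rewrite mulrCA gtr_pMr ?divr_gt0// ltr_pdivrMr// mul1r; lra.
  have M1 : M + 1 != 0 by rewrite gt_eqF//; lra.
  by rewrite mulfVK// in h1; lra.
(* Two open half-spaces are cut at the midpoint [m] by a norming functional of [x - y]. *)
- move=> x y xy; have [f [bf fxy]] := norming_functional (x - y).
  have n0 : 0 < `|x - y| by rewrite normr_gt0 subr_eq0; exact/eqP.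
  rewrite (lin_functionalB bf.1) in fxy.
  pose m := (f x + f y) / 2.
  exists (f @^-1` [set r | r > m]), (f @^-1` [set r | r < m]); split.
  + by apply: weak_open_preimage bf _; exact: open_gt.
  + by apply: weak_open_preimage bf _; exact: open_lt.
  + by rewrite /= /m; lra.
  + by rewrite /= /m; lra.
  by apply/seteqP; split => // z [/= h1 h2]; have := lt_trans h1 h2; rewrite ltxx.
- move=> x U oU Ux; have [n [fs [e [e0 fsP eU]]]] := oU _ Ux.
  exists [set y | forall i, `|fs i y - fs i x| < e]; split => //.
  + exact: weak_ball_open.
  + by apply: convex_weak_ball => i; have [] := fsP i.
  + by move=> i /=; rewrite subrr normr0.
Qed.

Lemma weak_open_open U : weak_open U -> open U.
Proof.
move=> oU; rewrite openE => x Ux; have [n [fs [e [e0 fsP eU]]]] := oU _ Ux.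
apply: filterS eU _.
apply: (@filter_forall _ _ (fun i y => `|fs i y - fs i x| < e)) => i.
have /cvgrPdist_lt /(_ e e0) := (fsP i).2 x.
by apply: filterS => y; rewrite distrC.
Qed.

(** A point outside the closure has positive distance to [C]. Empty [C] is treated apart, since
    [convex_separation] wants a point. *)
Lemma closure_separation C x : Defs.convex_set C -> ~ closure C x ->
  exists f r, [/\ bounded_functional f 1, 0 < r & forall y, C y -> f y + r <= f x].
Proof.
move=> cC nx; have [C0|/set0P C0] := eqVneq C set0.
  exists (fun=> 0), 1; split => // [|y]; last by rewrite C0.
  by split=> [a u v|u]; rewrite ?mulr0 ?addr0// mul1r.
have [r r0 rC] : exists2 r : R, 0 < r & forall y, C y -> r <= `|x - y|.
  apply: contrapT => nr; apply: nx => B /nbhs_normP[r /= r0 rB].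
  apply: contrapT => nCB; apply: nr; exists r => // y Cy.
  rewrite leNgt; apply/negP => xy; apply: nCB; exists y; split => //; exact: rB.
by have [f [bf fP]] := convex_separation cC C0 rC; exists f, r.
Qed.

(** Mazur's theorem: a functional separating [x] from the norm closure gives a weakly open
    half-space around [x] that misses [C]. Conversely, weakly open sets are norm open. *)
Lemma weak_closure_convex C : Defs.convex_set C ->
  top_closure (@weak_open R V) C = closure C.
Proof.
move=> cC; apply/seteqP; split=> x clx; last first.
  move=> U oU Ux; have [|y [Cy Uy]] := clx U; last by exists y.
  by apply: open_nbhs_nbhs; split => //; exact: weak_open_open.
apply: contrapT => /(closure_separation cC)[f [r [bf r0 fr]]].
have [|/=|y [/= fy Cy]] := clx (f @^-1` [set s | s > f x - r]).
- by apply: weak_open_preimage bf _; exact: open_gt.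
- lra.
by have := fr _ Cy; lra.
Qed.

Lemma closed_convex_weakly_closed C : Defs.convex_set C -> closed C ->
  top_closed (@weak_open R V) C.
Proof.
move=> cC clC x nCx.
have [|f [r [bf r0 fr]]] := @closure_separation C x cC.
  by rewrite -(closure_id C).1.
exists 1%N, (fun=> f), r; split => // [_|y /(_ ord0) fy Cy].
  by split; [exact: bf.1|exact: bounded_functional_continuous bf].
by have := fr _ Cy; move: fy; rewrite ltr_norml => /andP[]; lra.
Qed.

Lemma weakly_compact_functional_bounded K f N : weakly_compact K ->
  bounded_functional f N -> exists M, forall x, K x -> `|f x| <= M.
Proof.
move=> cK bf.
have [||n [g Kg]] := cK nat (fun n => f @^-1` [set r | `|r| < n%:R]).
- move=> n; apply: weak_open_preimage bf _.
  suff -> : [set r : R | `|r| < n%:R] = ball 0 n%:R by exact: ball_open.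
  by apply/seteqP; split=> r; rewrite /= /ball /= sub0r normrN.
- by move=> x _; exists (Num.bound `|f x|) => //=; exact: archi_boundP.
have [M MP] := ord_forall_bounded (fun i => (g i)%:R : R).
by exists M => x /Kg[j _ /= fx]; rewrite (le_trans (ltW fx)).
Qed.

Lemma weakly_compact_bounded K : weakly_compact K ->
  exists M, forall x, K x -> `|x| <= M.
Proof.
by move=> cK; apply: weakly_bounded_bounded => f N; exact: weakly_compact_functional_bounded.
Qed.

End WeakTopology.

(** * Convex hulls and extreme points *)

Section ConvexHull.
Variables (R : realType) (V : completeNormedModType R).
Implicit Types (A B C S : set V).

Lemma sub_conv_hull S : S `<=` conv_hull S.
Proof. by move=> x Sx C _; exact. Qed.

Lemma conv_hull_min S C : Defs.convex_set C -> S `<=` C -> conv_hull S `<=` C.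
Proof. by move=> cC SC x Sx; exact: (Sx _ cC SC). Qed.

Lemma convex_conv_hull S : Defs.convex_set (conv_hull S).
Proof. by move=> x y t Sx Sy t0 t1 C cC SC; apply: (cC) => //; [exact: (Sx _ cC SC)|exact: (Sy _ cC SC)]. Qed.

Lemma conv_hull_mono A B : A `<=` B -> conv_hull A `<=` conv_hull B.
Proof.
move=> AB; apply: conv_hull_min; first exact: convex_conv_hull.
by move=> x /AB; exact: sub_conv_hull.
Qed.

Lemma conv_hull0 : conv_hull (@set0 V) = set0.
Proof. by apply/seteqP; split=> // x; apply: conv_hull_min => // ? ? ? []. Qed.

(** The combinations on the right form a convex set containing [A] and [B]; nonemptiness supplies
    the point of weight 0. *)
Lemma conv_hullU_split A B x : A !=set0 -> B !=set0 -> conv_hull (A `|` B) x ->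
  exists (t : R) y z, [/\ 0 <= t <= 1, conv_hull A y, conv_hull B z
                  & x = (1 - t) *: y + t *: z].
Proof.
move=> [a Aa] [b Bb].
pose D := [set x | exists (t : R) y z, [/\ 0 <= t <= 1, conv_hull A y,
  conv_hull B z & x = (1 - t) *: y + t *: z]].
suff : conv_hull (A `|` B) `<=` D by apply.
apply: conv_hull_min; last first.
  move=> y [Ay|By].
    exists 0, y, b; split; [lra|exact: sub_conv_hull|exact: sub_conv_hull|].
    by rewrite scale0r addr0 subr0 scale1r.
  exists 1, a, y; split; [lra|exact: sub_conv_hull|exact: sub_conv_hull|].
  by rewrite subrr scale0r add0r scale1r.
move=> _ _ s [t [y [z [/andP[t0 t1] Ay Bz ->]]]] [t' [y' [z' [/andP[t0' t1'] Ay' Bz' ->]]]] s0 s1.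
have [||y'' Ay'' ey] := @convex_set_weights _ _ _ _ _ ((1 - s) * (1 - t)) (s * (1 - t'))
    (@convex_conv_hull A) Ay Ay'.
- by rewrite mulr_ge0// subr_ge0.
- by rewrite mulr_ge0// subr_ge0.
have [||z'' Bz'' ez] := @convex_set_weights _ _ _ _ _ ((1 - s) * t) (s * t')
    (@convex_conv_hull B) Bz Bz'.
- by rewrite mulr_ge0// subr_ge0.
- by rewrite mulr_ge0.
exists ((1 - s) * t + s * t'), y'', z''; split => //.
  have h1 : 0 <= (1 - s) * t by rewrite mulr_ge0// subr_ge0.
  have h2 : 0 <= s * t' by rewrite mulr_ge0.
  have h3 : 0 <= (1 - s) * (1 - t) by rewrite mulr_ge0// subr_ge0.
  have h4 : 0 <= s * (1 - t') by rewrite mulr_ge0// subr_ge0.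
  by apply/andP; split; lra.
rewrite -ez.
have -> : 1 - ((1 - s) * t + s * t') = (1 - s) * (1 - t) + s * (1 - t') by ring.
by rewrite -ey !scalerDr !scalerA addrACA.
Qed.

End ConvexHull.

(** * Convergence in a locally convex Hausdorff topology *)

Section TauConvergence.
Variables (R : realType) (V : completeNormedModType R) (tau : set (set V)).
Hypothesis Htau : lc_hausdorff_topology tau.
Implicit Types (C D K : set V) (x y : V).

Section maps.
Context (T : Type) (G : set_system T) {FG : ProperFilter G}.
Implicit Types (u v : T -> V).

Lemma tau_cvgD u v x y : tau_cvg tau (u @ G) x -> tau_cvg tau (v @ G) y ->
  tau_cvg tau ((fun t => u t + v t) @ G) (x + y).
Proof.
move=> ux vy U oU Uxy; have [_ Hadd _ _ _] := Htau.
have [A [B [oA oB Ax By AB]]] := Hadd _ _ _ oU Uxy.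
exact: (@filterS2 _ G _ _ _ _ (fun t => AB (u t) (v t)) (ux _ oA Ax) (vy _ oB By)).
Qed.

Lemma tau_cvgZ (r : T -> R) u (c : R) x : r @ G --> c -> tau_cvg tau (u @ G) x ->
  tau_cvg tau ((fun t => r t *: u t) @ G) (c *: x).
Proof.
move=> rc ux U oU Ucx; have [_ _ Hsc _ _] := Htau.
have [d [B [d0 oB Bx dB]]] := Hsc _ _ _ oU Ucx.
have /cvgrPdist_lt /(_ d d0) rd := rc.
have rB t : `|c - r t| < d -> B (u t) -> U (r t *: u t).
  by rewrite distrC; exact: dB.
exact: (@filterS2 _ G _ _ _ _ rB rd (ux _ oB Bx)).
Qed.

Lemma tau_cvgB u v x y : tau_cvg tau (u @ G) x -> tau_cvg tau (v @ G) y ->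
  tau_cvg tau ((fun t => u t - v t) @ G) (x - y).
Proof.
move=> ux vy; rewrite -scaleN1r.
rewrite (_ : (fun t => _) = fun t => u t + (-1) *: v t); last first.
  by apply/funext => t; rewrite scaleN1r.
by apply: tau_cvgD => //; apply: (@tau_cvgZ (fun=> -1)) => //; exact: cvg_cst.
Qed.

Lemma tau_cvg_unique u x y : tau_cvg tau (u @ G) x -> tau_cvg tau (u @ G) y -> x = y.
Proof.
move=> ux uy; apply: contrapT => xy; have [_ _ _ Hh _] := Htau.
have [A [B [oA oB Ax By AB]]] := Hh _ _ xy.
have GAB : G ((u @^-1` A) `&` (u @^-1` B)).
  by apply: filterI; [exact: ux|exact: uy].
have [t [Au Bu]] := filter_ex GAB.
by have : set0 (u t) by rewrite -AB.
Qed.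

Lemma tau_cvg_closed u x C : top_closed tau C -> G [set t | C (u t)] ->
  tau_cvg tau (u @ G) x -> C x.
Proof.
move=> clC GC ux; apply: contrapT => nCx.
have GCn : G ([set t | C (u t)] `&` [set t | ~ C (u t)]).
  by apply: filterI => //; exact: ux clC nCx.
by have [t []] := filter_ex GCn.
Qed.

Lemma tau_cvg_closure u x C : G [set t | C (u t)] ->
  tau_cvg tau (u @ G) x -> top_closure tau C x.
Proof.
move=> GC ux U oU Ux; have GUC : G ((u @^-1` U) `&` [set t | C (u t)]).
  by apply: filterI => //; exact: ux.
by have [t [? ?]] := filter_ex GUC; exists (u t).
Qed.

End maps.

Lemma top_closure_ultra C x : top_closure tau C x ->
  exists G : set_system V, [/\ UltraFilter G, G C & tau_cvg tau G x].
Proof.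
move=> clx; have [[opT _ opI] _ _ _ _] := Htau.
pose D := [set U | tau U /\ U x].
have PF : ProperFilter (filter_from D (fun U => U `&` C)).
  apply: filter_from_proper; last by move=> U [oU Ux]; exact: clx.
  apply: filter_from_filter; first by exists setT.
  move=> U W [oU Ux] [oW Wx]; exists (U `&` W); first by split => //; exact: opI.
  by move=> y [[Uy Wy] Cy].
have [G [GU sG]] := ultraFilterLemma PF; exists G; split => //.
  by apply: sG; exists setT => // y [].
by move=> U oU Ux; apply: sG; exists U => // y [].
Qed.

Lemma top_closure_mono C D : C `<=` D -> top_closure tau C `<=` top_closure tau D.
Proof. by move=> CD x clx U oU Ux; have [y [Uy /CD]] := clx _ oU Ux; exists y. Qed.

(** The limit may lie outside [C]. This form covers both a hull with compact closure and the
    conclusion of the Krein-Smulian theorem. *)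
Definition relatively_tau_compact C :=
  forall G : set_system V, UltraFilter G -> G C -> exists x, tau_cvg tau G x.

(** * Milman's converse to the Krein-Milman theorem *)

Section Milman.
Variables (K D : set V) (a : V).
Hypothesis cptK : relatively_tau_compact (conv_hull K).
Hypothesis KD : top_closure tau (conv_hull K) `<=` D.
Hypothesis exta : forall x y (t : R), D x -> D y -> 0 < t -> t < 1 ->
  a = (1 - t) *: x + t *: y -> x = a /\ y = a.

(** Along an ultrafilter converging to [a], each point is split into parts in the two hulls. The
    weights and both parts converge, so [a] is a convex combination of two points of [D], and
    extremality makes it one of them. *)
Lemma extreme_closure_hullU A B : A `<=` K -> B `<=` K ->
  top_closure tau (conv_hull (A `|` B)) a ->
  top_closure tau (conv_hull A) a \/ top_closure tau (conv_hull B) a.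
Proof.
move=> AK BK; have [->|/set0P A0] := eqVneq A set0; first by rewrite set0U; right.
have [->|/set0P B0] := eqVneq B set0; first by rewrite setU0; left.
move=> /top_closure_ultra[G [GU GAB Ga]].
have [|p pP] := @choice V (R * V * V)%type (fun x p => conv_hull (A `|` B) x ->
    [/\ 0 <= p.1.1 <= 1, conv_hull A p.1.2, conv_hull B p.2
      & x = (1 - p.1.1) *: p.1.2 + p.1.1 *: p.2]).
  move=> x; have [cx|ncx] := pselect (conv_hull (A `|` B) x).
    by have [t [y [z P]]] := conv_hullU_split A0 B0 cx; exists (t, y, z).
  by exists (0, 0, 0).
have GA : G [set x | conv_hull A (p x).1.2] by apply: filterS GAB => x /pP[].
have GB : G [set x | conv_hull B (p x).2] by apply: filterS GAB => x /pP[].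
have sub S (q : V -> V) : S `<=` K -> G [set x | conv_hull S (q x)] ->
    exists2 y, tau_cvg tau (q @ G) y & top_closure tau (conv_hull S) y /\ D y.
  move=> SK GS; have [|y qy] := cptK (fmap_ultra q GU).
    by apply: (filterS _ GS) => x; exact: conv_hull_mono.
  exists y => //; have cy : top_closure tau (conv_hull S) y by exact: tau_cvg_closure GS qy.
  split => //; exact: (KD (top_closure_mono (conv_hull_mono SK) cy)).
have [y py [clAy Dy]] := sub _ _ AK GA.
have [z pz [clBz Dz]] := sub _ _ BK GB.
have Gt : G [set x | 0 <= (p x).1.1 <= 1] by apply: filterS GAB => x /pP[].
have : cvg ((fun x => (p x).1.1) @ G).
  apply: (@ultra_bounded_cvg _ _ _ _ 1); apply: filterS Gt => x /=.
  by move=> /andP[h1 h2]; rewrite ger0_norm.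
move=> /cvg_ex[t pt].
have t01 : 0 <= t <= 1.
  apply/andP; split.
    rewrite -(cvg_lim _ pt)//; apply: limr_ge; first by apply/cvg_ex; exists t.
    by apply: filterS Gt => x /andP[].
  rewrite -(cvg_lim _ pt)//; apply: limr_le; first by apply/cvg_ex; exists t.
  by apply: filterS Gt => x /andP[].
have ea : a = (1 - t) *: y + t *: z.
  apply: (@tau_cvg_unique _ G _ id) => //.
  have c1 : (fun x => 1 - (p x).1.1) @ G --> 1 - t.
    by apply: cvgB => //; exact: cvg_cst.
  move=> U oU Ux; have GU' : G [set x | U ((1 - (p x).1.1) *: (p x).1.2 + (p x).1.1 *: (p x).2)].
    by apply: tau_cvgD U oU Ux; exact: tau_cvgZ.
  have pU x : conv_hull (A `|` B) x ->
      U ((1 - (p x).1.1) *: (p x).1.2 + (p x).1.1 *: (p x).2) -> U x.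
    by case/pP=> _ _ _ e; rewrite -e.
  exact: (@filterS2 _ G _ _ _ _ pU GAB GU').
(* Extremality covers only [0 < t < 1]; at the end points [a] is already one of the two limits. *)
have [t0|t0] := eqVneq t 0; first by left; rewrite ea t0 scale0r addr0 subr0 scale1r.
have [t1|t1] := eqVneq t 1; first by right; rewrite ea t1 subrr scale0r add0r scale1r.
have [] := exta Dy Dz _ _ ea; [lra|lra|].
by move=> <- _; left.
Qed.

Lemma extreme_closure_hull_ord n (A : 'I_n -> set V) : (forall i, A i `<=` K) ->
  top_closure tau (conv_hull [set x | exists i, A i x]) a ->
  exists i, top_closure tau (conv_hull (A i)) a.
Proof.
elim: n A => [|n IH] A AK.
  have -> : [set x | exists i, A i x] = set0 by apply/seteqP; split=> // x [[]].
  rewrite conv_hull0 => /(_ setT) []//; first by have [[]] := Htau.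
  by move=> x [].
have -> : [set x | exists i, A i x] =
    A ord0 `|` [set x | exists i, A (lift ord0 i) x].
  apply/seteqP; split=> x.
    by move=> [i]; case: (unliftP ord0 i) => [j|] ->; [right; exists j|left].
  by move=> [Ax|[i Ax]]; [exists ord0|exists (lift ord0 i)].
move=> /extreme_closure_hullU[//|x [i /AK]//|Aa|]; first by exists ord0.
by move=> /IH[i|i Ai]; [exact: AK|exists (lift ord0 i)].
Qed.

(** Finitely many convex open sets whose closures miss [a] cover [K]. Then [a] lies in the closed
    hull of the part of [K] inside one of them, hence in its closure, a contradiction. *)
Lemma Milman : top_compact tau K -> top_closure tau (conv_hull K) a -> K a.
Proof.
move=> cK cla; apply: contrapT => nKa; have [[opT _ _] _ _ Hh Hlc] := Htau.
pose I := {W : set V | [/\ tau W, Defs.convex_set W & ~ top_closure tau W a]}.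
have [||n [g Kg]] := cK I (fun i => sval i); first by move=> [W []].
  move=> x Kx; have ax : a <> x by move=> ax; apply: nKa; rewrite ax.
  have [A [B [oA oB Aa Bx AB]]] := Hh _ _ ax.
  have [W [oW cW Wx WB]] := Hlc _ _ oB Bx.
  have nW : ~ top_closure tau W a.
    move=> /(_ A oA Aa)[y [Ay /WB By]].
    by have : set0 y by rewrite -AB.
  by exists (exist _ W (And3 oW cW nW)).
have [||i clai] := @extreme_closure_hull_ord n (fun i => K `&` sval (g i)).
- by move=> i x [].
- apply: top_closure_mono cla; apply: conv_hull_mono => x Kx.
  by have [j _ gx] := Kg _ Kx; exists j.
have : top_closure tau (sval (g i)) a.
  apply: top_closure_mono clai; apply: conv_hull_min; last by move=> x [].
  by case: (g i) => W [].
by case: (g i) => W [].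
Qed.

End Milman.
End TauConvergence.

(** * Order extreme points in Riesz spaces *)

Section OrderExtreme.
Variables (R : realType) (V : completeNormedModType R) (le : V -> V -> Prop).
Hypothesis HL : riesz_space le.
Implicit Types (x y z : V) (K : set V).

Lemma riesz_refl x : le x x. Proof. by have [[]] := HL. Qed.

Lemma riesz_anti x y : le x y -> le y x -> x = y.
Proof. by have [[_ [H _]] _ _ _] := HL; exact: H. Qed.

Lemma riesz_trans x y z : le x y -> le y z -> le x z.
Proof. by have [[_ [_ H]] _ _ _] := HL; exact: H. Qed.

Lemma rieszD x y z w : le x y -> le z w -> le (x + z) (y + w).
Proof.
have [_ H _ _] := HL => xy zw; apply: riesz_trans (H _ _ z xy) _.
by rewrite ![y + _]addrC; exact: H.
Qed.

Lemma rieszZ (a : R) x y : 0 <= a -> le x y -> le (a *: x) (a *: y).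
Proof. by have [_ _ H _] := HL; exact: H. Qed.

Lemma riesz_sub x y : le 0 (y - x) <-> le x y.
Proof.
split=> h; first by have := rieszD h (riesz_refl x); rewrite add0r subrK.
by have := rieszD h (riesz_refl (- x)); rewrite subrr.
Qed.

Lemma rieszN x y : le x y -> le (- y) (- x).
Proof. by move=> /riesz_sub h; apply/riesz_sub; rewrite opprK addrC. Qed.

Lemma is_lub2_unique x y z w : is_lub2 le x y z -> is_lub2 le x y w -> z = w.
Proof. by move=> [xz [yz zm]] [xw [yw wm]]; apply: riesz_anti; [exact: zm|exact: wm]. Qed.

Lemma vsupP x y : is_lub2 le x y (vsup le x y).
Proof. by have [_ _ _ /(_ x y) H] := HL; rewrite /vsup; case: xgetP => // h; case: H => z /h. Qed.

Lemma le_vabs x : le x (vabs le x). Proof. exact: (vsupP x (- x)).1. Qed.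

Lemma leN_vabs x : le (- x) (vabs le x). Proof. exact: (vsupP x (- x)).2.1. Qed.

Lemma vabs_le x y : le x y -> le (- x) y -> le (vabs le x) y.
Proof. by move=> h1 h2; exact: (vsupP x (- x)).2.2. Qed.

Lemma vabs_ge0 x : le 0 (vabs le x).
Proof.
have := rieszD (le_vabs x) (leN_vabs x); rewrite subrr => h.
have := @rieszZ (1 / 2) _ _ (_ : 0 <= 1 / 2) h.
have e : 1 / 2 + 1 / 2 = 1 :> R by lra.
by rewrite scaler0 scalerDr -scalerDl e scale1r; apply; lra.
Qed.

(** The set [E] is convex, solid and contains [K]. Two inequalities in place of one on [vabs] make
    convexity immediate. *)
Lemma sch_le K x : K `<=` pos_cone le -> sch le K x ->
  exists2 y, conv_hull K y & le x y /\ le (- x) y.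
Proof.
move=> Kpos; pose E := [set x | exists2 y, conv_hull K y & le x y /\ le (- x) y].
suff : sch le K `<=` E by apply.
move=> {}x; apply.
- move=> u v t [y Ky [uy Nuy]] [z Kz [vz Nvz]] t0 t1.
  exists ((1 - t) *: y + t *: z); first exact: convex_conv_hull.
  by split; rewrite ?opprD -?scalerN; apply: rieszD; apply: rieszZ; rewrite ?subr_ge0.
- move=> u v [y Ky [vy Nvy]] uv; exists y => //.
  by split; apply: riesz_trans (riesz_trans uv (vabs_le vy Nvy)); [exact: le_vabs|exact: leN_vabs].
- move=> u Ku; exists u; first exact: sub_conv_hull.
  split; first exact: riesz_refl.
  apply: (@riesz_trans _ 0); last exact: Kpos.
  by have := rieszN (Kpos _ Ku); rewrite oppr0.
Qed.

Lemma conv_hull_sch K : conv_hull K `<=` sch le K.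
Proof. by move=> x Kx C cC _ KC; exact: (Kx _ cC KC). Qed.

Lemma convex_sch K : Defs.convex_set (sch le K).
Proof. by move=> x y t Kx Ky t0 t1 C cC sC KC; apply: (cC) => //; [exact: (Kx _ cC sC KC)|exact: (Ky _ cC sC KC)]. Qed.

Lemma oep_tau_sch (tau : set (set V)) K : lc_hausdorff_topology tau ->
  top_closed tau (pos_cone le) -> K `<=` pos_cone le -> top_compact tau K ->
  relatively_tau_compact tau (conv_hull K) ->
  oep le (top_closure tau (sch le K)) `<=` K.
Proof.
move=> Htau clpos Kpos cK rK a [cla exta].
have KD := @top_closure_mono _ _ tau _ _ (@conv_hull_sch K).
have [G [GU GK Ga]] := top_closure_ultra Htau cla.
have [|q qP] := @choice V V (fun x y => sch le K x -> conv_hull K y /\ le x y).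
  move=> x; have [Kx|nKx] := pselect (sch le K x); last by exists 0.
  by have [y Ky [xy _]] := sch_le Kpos Kx; exists y.
have Gq : G [set x | conv_hull K (q x)] by apply: filterS GK => x /qP[].
have [y qy] := rK _ (fmap_ultra q GU) Gq.
have clKy : top_closure tau (conv_hull K) y by exact: tau_cvg_closure Gq qy.
(* The inequality [x <= q x] passes to the limit because the positive cone is closed. *)
have ay : le a y.
  have GE : G [set x | le 0 (q x - x)].
    by apply: filterS GK => x /qP[_ xq]; apply/riesz_sub.
  have cE : tau_cvg tau ((fun x => q x - x) @ G) (y - a).
    exact: (tau_cvgB Htau (v := id) qy Ga).
  by apply/riesz_sub; exact: (tau_cvg_closed (C := pos_cone le) clpos GE cE).
(* Order extremeness is applied to the midpoint of [y] with itself. *)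
have [ya _] : y = a /\ y = a.
  apply: (exta y y (1 / 2)); [exact: KD|exact: KD|lra|lra|].
  by rewrite -scalerDl subrK scale1r.
apply: (@Milman _ _ tau Htau K (top_closure tau (sch le K))) => //; last by rewrite -ya.
(* By reflexivity of the order, an order extreme point is extreme in the usual sense. *)
by move=> x z t Dx Dz t0 t1 e; apply: (exta x z t) => //; rewrite -e; exact: riesz_refl.
Qed.

End OrderExtreme.

(** * The Krein-Smulian theorem *)

Section Means.
Variables (R : realType) (V : completeNormedModType R) (K : set V).
Implicit Types (phi psi : V -> R) (I : (V -> R) -> R).

Definition bounded_on phi := exists M : R, forall x, K x -> `|phi x| <= M.

(** This is integration against a finitely additive probability on [K]. As [I] is total, its laws
    are confined to functions bounded on [K]. *)
Definition mean_on I : Prop :=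
  [/\ forall a phi psi, bounded_on phi -> bounded_on psi ->
        I (fun x => a * phi x + psi x) = a * I phi + I psi,
      forall phi, bounded_on phi -> (forall x, K x -> 0 <= phi x) -> 0 <= I phi
    & I (fun=> 1) = 1].

Lemma bounded_on_cst (a : R) : bounded_on (fun=> a).
Proof. by exists `|a|. Qed.

Lemma bounded_on_lin (a : R) phi psi : bounded_on phi -> bounded_on psi ->
  bounded_on (fun x => a * phi x + psi x).
Proof.
move=> [M phiM] [N psiN]; exists (`|a| * M + N) => x Kx.
rewrite (le_trans (ler_normD _ _))// normrM lerD ?psiN//.
by rewrite ler_wpM2l// phiM.
Qed.

Section mean_on.
Variables (I : (V -> R) -> R) (mI : mean_on I).

Lemma mean_cst a : I (fun=> a) = a.
Proof.
have [Il _ I1] := mI.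
have I0 : I (fun=> 0) = 0.
  have := Il 1 _ _ (bounded_on_cst 0) (bounded_on_cst 0).
  rewrite (_ : (fun=> 1 * 0 + 0) = fun=> 0); first lra.
  by apply/funext => x; lra.
have := Il a _ _ (bounded_on_cst 1) (bounded_on_cst 0).
rewrite I0 I1 (_ : (fun=> a * 1 + 0) = fun=> a); first lra.
by apply/funext => x; lra.
Qed.

Lemma meanZ a phi : bounded_on phi -> I (fun x => a * phi x) = a * I phi.
Proof.
move=> bphi; have [Il _ _] := mI.
have := Il a _ _ bphi (bounded_on_cst 0); rewrite mean_cst addr0 => <-.
by congr I; apply/funext => x; rewrite addr0.
Qed.

Lemma meanD phi psi : bounded_on phi -> bounded_on psi ->
  I (fun x => phi x + psi x) = I phi + I psi.
Proof.
move=> bphi bpsi; have [Il _ _] := mI.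
have := Il 1 _ _ bphi bpsi; rewrite mul1r => <-.
by congr I; apply/funext => x; rewrite mul1r.
Qed.

Lemma le_mean phi psi : bounded_on phi -> bounded_on psi ->
  (forall x, K x -> phi x <= psi x) -> I phi <= I psi.
Proof.
move=> bphi bpsi le; have [Il I0 _] := mI.
have := I0 _ (bounded_on_lin (-1) bphi bpsi).
rewrite Il// mulN1r addrC subr_ge0; apply => x Kx.
by rewrite mulN1r addrC subr_ge0 le.
Qed.

Lemma mean_abs_le phi (M : R) : (forall x, K x -> `|phi x| <= M) -> `|I phi| <= M.
Proof.
move=> phiM; have bphi : bounded_on phi by exists M.
rewrite ler_norml; apply/andP; split.
  rewrite -[leLHS]mean_cst; apply: le_mean => //; first exact: bounded_on_cst.
  by move=> x /phiM; rewrite ler_norml => /andP[].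
rewrite -[leRHS]mean_cst; apply: le_mean => //; first exact: bounded_on_cst.
by move=> x /phiM; rewrite ler_norml => /andP[].
Qed.

End mean_on.

(** Points of [K] are represented by evaluations, and the points represented by some mean form a
    convex set. *)
Lemma conv_hull_mean y : conv_hull K y -> exists I, mean_on I /\
  forall f N, bounded_functional f N -> I f = f y.
Proof.
pose D := [set y : V | exists I, mean_on I /\
  forall f N, bounded_functional f N -> I f = f y].
suff : conv_hull K `<=` D by apply.
apply: conv_hull_min; last first.
  by move=> x Kx; exists (fun phi => phi x); split => //; split => // phi _ phi0; exact: phi0.
move=> u v t [I [[Il I0 I1] If]] [J [[Jl J0 J1] Jf]] t0 t1.
exists (fun phi => (1 - t) * I phi + t * J phi); split.
  split.
  - by move=> a phi psi bphi bpsi; rewrite Il// Jl//; ring.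
  - move=> phi bphi phi0; rewrite addr_ge0// mulr_ge0 ?subr_ge0//.
      exact: I0.
    exact: J0.
  - by rewrite I1 J1; ring.
move=> f N bf; rewrite (If _ _ bf) (Jf _ _ bf) (lin_functionalD bf.1).
by rewrite !(lin_functionalZ bf.1).
Qed.

(** [I] is the limit along [G] of means representing the points of the hull; a bound of the function
    on [K] bounds these means too, so the limit exists. *)
Lemma ultra_mean (G : set_system V) :
  (forall f N, bounded_functional f N -> bounded_on f) -> UltraFilter G -> G (conv_hull K) ->
  exists I, mean_on I /\ forall f N, bounded_functional f N -> f @ G --> I f.
Proof.
move=> bK GU GK.
have [|m mP] := @choice V ((V -> R) -> R) (fun y I => conv_hull K y -> mean_on I /\
    forall f N, bounded_functional f N -> I f = f y).
  move=> y; have [Ky|nKy] := pselect (conv_hull K y); last by exists (fun=> 0).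
  by have [I IP] := conv_hull_mean Ky; exists I.
have mcvg phi : bounded_on phi -> cvg ((fun y => m y phi) @ G).
  move=> [M phiM]; apply: (@ultra_bounded_cvg _ _ _ _ M).
  by apply: (filterS _ GK) => y /mP[my _]; exact: mean_abs_le my _ _ phiM.
exists (fun phi => lim ((fun y => m y phi) @ G)); split; last first.
  move=> f N bf; apply: cvg_trans (mcvg f (bK _ _ bf)).
  by apply: near_eq_cvg; apply: (filterS _ GK) => y /mP[_ my]; exact: my bf.
split.
- move=> a phi psi bphi bpsi; apply: cvg_lim => //.
  apply: (@cvg_trans _ ((fun y => a * m y phi + m y psi) @ G)).
    apply: near_eq_cvg; apply: (filterS _ GK) => y /mP[[Il _ _] _] /=.
    by rewrite Il.
  by apply: cvgD; [apply: cvgM; [exact: cvg_cst|]|]; exact: mcvg.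
- move=> phi bphi phi0; apply: limr_ge; first exact: mcvg.
  by apply: (filterS _ GK) => y /mP[[_ I0 _] _] /=; exact: I0.
- apply: cvg_lim => //; apply: (@cvg_trans _ ((fun=> 1) @ G)); last exact: cvg_cst.
  by apply: near_eq_cvg; apply: (filterS _ GK) => y /mP[[_ _ I1] _] /=; rewrite I1.
Qed.

End Means.

(** * Functionals separating a finite set from a mean *)

Section FiniteSelection.
Variables (R : realType) (V : completeNormedModType R).
Variables (Phi : (V -> R) -> R) (e : R).
Hypothesis PhiD : forall f g N M, bounded_functional f N -> bounded_functional g M ->
  Phi (fun x => f x + g x) = Phi f + Phi g.
Hypothesis PhiZ : forall a f N, bounded_functional f N ->
  Phi (fun x => a * f x) = a * Phi f.
Hypothesis Phi_far : forall x, exists f (N : R),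
  [/\ 0 < N, bounded_functional f N & e * N < Phi f - f x].

(* A minimax argument: if no [f] works for all the [s i], Hahn-Banach in R^m yields weights [l i] such that [x := \sum_i l i *: s i] violates [Phi_far]. *)
Lemma finite_selection m (s : 'I_m -> V) :
  exists f, bounded_functional f 1 /\ forall i, e < Phi f - f (s i).
Proof.
case: m s => [|m] s.
  by exists (fun=> 0); split=> [|[]//]; split=> [a x y|x]; rewrite ?mulr0 ?addr0// mul1r.
apply: contrapT => nf.
(* Rescaling by [N^-1] extends the failure from bound 1 to any positive bound [N]. *)
have H g (N : R) : 0 < N -> bounded_functional g N -> exists i, Phi g - g (s i) <= e * N.
  move=> N0 bg; apply: contrapT => ni; apply: nf; exists (fun x => N^-1 * g x).
  have := bounded_functionalZ (_ : 0 <= N^-1) bg.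
  rewrite mulVf ?gt_eqF// invr_ge0 ltW// => /(_ isT) bf; split => // i.
  rewrite (PhiZ _ bg) -mulrBr mulrC ltr_pdivlMr// ltNge; apply/negP => ?.
  by apply: ni; exists i.
have Phi0 : Phi (fun=> 0) = 0.
  by have := PhiZ 0 (bounded_functional0 V); rewrite !mul0r.
(* This is the epigraph of the infimum, over [g] and [N], of the largest coordinate of
   [v i - (Phi g - g (s i) - e * N)]; [H] keeps it nonnegative at 0. *)
pose P (v : 'rV[R]_m.+1) (c : R) := exists g (N : R), [/\ 0 <= N, bounded_functional g N &
  forall i, v 0 i <= Phi g - g (s i) - e * N + c].
have [|l [ll lP]] := @Hahn_Banach_rel R _ P.
  split.
  - move=> u v c d [g [N [N0 bg gP]]] [h [M [M0 bh hP]]].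
    exists (fun x => g x + h x), (N + M); split.
    + exact: addr_ge0.
    + exact: bounded_functionalD.
    + by move=> i; rewrite mxE (PhiD bg bh); have := gP i; have := hP i; lra.
  - move=> a v c a0 [g [N [N0 bg gP]]].
    exists (fun x => a * g x), (a * N); split.
    + exact: mulr_ge0.
    + exact: bounded_functionalZ.
    + move=> i; rewrite mxE (PhiZ _ bg).
      by have := ler_wpM2l a0 (gP i); lra.
  - move=> c [g [N [N0 bg gP]]].
    have [N_0|N_0] := eqVneq N 0; last first.
      have [|i gi] := H g N _ bg; first by rewrite lt_neqAle eq_sym N_0.
      by have := gP i; rewrite mxE; lra.
    have g0 : g = fun=> 0.
      apply/funext => x; have := bounded_functional_abs x bg.
      by rewrite N_0 mul0r normr_le0 => /eqP.
    by have := gP ord0; rewrite mxE g0 Phi0 N_0; lra.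
  - move=> v; have [c cP] := ord_forall_bounded (fun i => v 0 i).
    exists c, (fun=> 0), 0; split => //; first exact: bounded_functional0.
    by move=> i; rewrite Phi0; have := cP i; lra.
have l0 : l 0 = 0 by have := ll 1 0 0; rewrite scaler0 addr0 mul1r; lra.
have lE (v : 'rV[R]_m.+1) : l v = \sum_i v 0 i * l (delta_mx 0 i).
  rewrite {1}[v]row_sum_delta.
  by elim/big_rec2: _ => [|i y1 y2 _ <-]//; rewrite ll.
have P0 (v : 'rV[R]_m.+1) c : (forall i, v 0 i <= c) -> l v <= c.
  move=> vc; apply: lP; exists (fun=> 0), 0; split => //; first exact: bounded_functional0.
  by move=> i; rewrite Phi0; have := vc i; lra.
(* Testing the constant rows 1 and -1 shows that the weights sum to 1. *)
have l1 : \sum_i l (delta_mx 0 i : 'rV[R]_m.+1) = 1.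
  apply/le_anti/andP; split.
    have := P0 (const_mx 1) 1; rewrite lE => H1.
    rewrite (eq_bigr (fun i => const_mx 1 (0 : 'I_1) i * l (delta_mx 0 i))).
      by apply: H1 => i; rewrite mxE.
    by move=> i _; rewrite mxE mul1r.
  have := P0 (const_mx (-1)) (-1); rewrite lE => H1.
  rewrite -lerN2 -sumrN.
  rewrite (eq_bigr (fun i => const_mx (-1) (0 : 'I_1) i * l (delta_mx 0 i))).
    by apply: H1 => i; rewrite mxE.
  by move=> i _; rewrite mxE mulN1r.
(* At the weighted sum of the [s i], [Phi_far] makes the value of [l] on the row of gaps positive,
   while [lP] makes it at most 0. *)
have [f [N [N0 bf fx]]] := Phi_far (\sum_i l (delta_mx 0 i) *: s i).
have : l (\row_i (Phi f - f (s i) - e * N)) <= 0.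
  by apply: lP; exists f, N; split => //; [exact: ltW|move=> i; rewrite mxE addr0].
rewrite lE (lin_functional_sum bf.1) in fx *.
rewrite (eq_bigr (fun i => (Phi f - e * N) * l (delta_mx 0 i) - l (delta_mx 0 i) * f (s i))).
  by rewrite sumrB -mulr_sumr l1; lra.
by move=> i _; rewrite mxE; ring.
Qed.

(** The sets of functionals that work for a finite family are nonempty by [finite_selection] and
    directed, so some ultrafilter contains them all. *)
Lemma selection_ultrafilter : exists G : set_system (V -> R), UltraFilter G /\
  forall x, G [set f | bounded_functional f 1 /\ e < Phi f - f x].
Proof.
pose B (s : {m : nat & 'I_m -> V}) :=
  [set f | bounded_functional f 1 /\ forall i, e < Phi f - f (projT2 s i)].
have PF : ProperFilter (filter_from setT B).
  apply: filter_from_proper; last first.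
    by move=> [m s] _; have [f fP] := finite_selection s; exists f.
  apply: filter_from_filter.
    by exists (existT _ 1%N (fun=> 0)).
  move=> [m s] [n t] _ _; exists (existT _ (m + n)%N (ord_cat s t)) => //.
  by move=> f [bf] /= /(ord_cat_all s t (fun y => e < Phi f - f y))[].
have [G [GU sG]] := ultraFilterLemma PF; exists G; split => // x.
apply: sG; exists (existT _ 1%N (fun=> x)) => // f [bf /(_ ord0)].
by [].
Qed.

End FiniteSelection.

(** * Alternating selection of functionals and points *)

Section KreinSmulian.
Variables (R : realType) (V : completeNormedModType R) (K : set V).
Variables (I : (V -> R) -> R) (mI : mean_on K I).
Variables (M e : R) (KM : forall x, K x -> `|x| <= M) (M0 : 0 < M) (e0 : 0 < e).
Variable G : set_system (V -> R).
Hypothesis GU : UltraFilter G.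
Hypothesis GP : forall x, G [set f | bounded_functional f 1 /\ e < I f - f x].
Implicit Types (A B D : set V).

Let mu A := I (\1_A).

Lemma indic_bounded_on A : bounded_on K (\1_A : V -> R).
Proof. by exists 1 => x _; rewrite indicE; case: (_ \in _); rewrite ?normr1 ?normr0. Qed.

Lemma indic_ge0 A x : 0 <= (\1_A x : R).
Proof. by rewrite indicE; case: (_ \in _). Qed.

Lemma indic1 A x : A x -> (\1_A x : R) = 1.
Proof. by move=> Ax; rewrite indicE mem_set. Qed.

Lemma indic0 A x : ~ A x -> (\1_A x : R) = 0.
Proof. by move=> Ax; rewrite indicE memNset. Qed.

Lemma le_mu A B : A `&` K `<=` B -> mu A <= mu B.
Proof.
move=> AB; apply: (le_mean mI); [exact: indic_bounded_on|exact: indic_bounded_on|].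
move=> x Kx; have [Ax|nAx] := pselect (A x); last by rewrite indic0// indic_ge0.
by rewrite !indic1//; exact: AB.
Qed.

Lemma mu_ge0 A : 0 <= mu A.
Proof. by have [_ I0 _] := mI; apply: I0 => [|x _]; [exact: indic_bounded_on|exact: indic_ge0]. Qed.

Lemma mu_le1 A : mu A <= 1.
Proof.
rewrite -(mean_cst mI 1); apply: (le_mean mI).
- exact: indic_bounded_on.
- exact: bounded_on_cst.
by move=> x _; rewrite indicE; case: (_ \in _).
Qed.

Lemma muUI A B : mu (A `|` B) + mu (A `&` B) = mu A + mu B.
Proof.
rewrite -!(meanD mI); try exact: indic_bounded_on.
congr I; apply/funext => x.
have [Ax|nAx] := pselect (A x); have [Bx|nBx] := pselect (B x).
- by rewrite !indic1//; left.
- by rewrite (indic1 Ax) (indic0 nBx) indic1 ?indic0//; [case|left].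
- by rewrite (indic0 nAx) (indic1 Bx) indic1 ?indic0 1?addrC//; [case|right].
- by rewrite (indic0 nAx) (indic0 nBx) !indic0//; case.
Qed.

Lemma mu_gt0_ex A : 0 < mu A -> exists2 x, K x & A x.
Proof.
move=> mA; apply: contrapT => nA.
have h : mu A <= mu set0 by apply: le_mu => x [Ax Kx]; apply: nA; exists x.
have mu0 : mu set0 = 0.
  by rewrite -(mean_cst mI 0); congr I; apply/funext => x; rewrite indic0.
by move: mA; rewrite ltNge -mu0 h.
Qed.

(* By [GP], every single point lies outside [B f] for most functionals [f], yet the mean of [B f] is bounded below. *)
Let B f : set V := [set x | I f - e / 2 <= f x].

(** On [K], [f] is at most [I f - e / 2] off [B f] and exceeds that value by at most [2 * M + e / 2]
    on it, since [f] and [I f] are bounded by [M]. Taking means gives the claim. *)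
Lemma mu_near_mean f : bounded_functional f 1 ->
  e / 2 <= (2 * M + e / 2) * mu (B f).
Proof.
move=> bf; have fM x : K x -> `|f x| <= M.
  by move=> Kx; have := bounded_functional_abs x bf; have := KM Kx; lra.
have bKf : bounded_on K f by exists M.
have := mean_abs_le mI fM; rewrite ler_norml => /andP[If1 If2].
rewrite -(meanZ mI); last exact: indic_bounded_on.
have : I f <= I (fun x => (2 * M + e / 2) * \1_(B f) x + (I f - e / 2)).
  apply: (le_mean mI) => //.
    by apply: bounded_on_lin; [exact: indic_bounded_on|exact: bounded_on_cst].
  move=> x Kx; have := fM _ Kx; rewrite ler_norml => /andP[f1 f2].
  have [Bx|nBx] := pselect (B f x); first by rewrite indic1//; lra.
  have fx : f x < I f - e / 2 by rewrite ltNge; exact/negP.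
  by rewrite indic0//; lra.
have [Il _ _] := mI.
rewrite Il; [|exact: indic_bounded_on|exact: bounded_on_cst].
by rewrite (mean_cst mI) (meanZ mI); [lra|exact: indic_bounded_on].
Qed.

(** Good sets are those from which the selection can continue: the bound [c] is uniform over a
    member of [G]. *)
Let good A := exists2 c, 0 < c & G [set f | c <= mu (A `&` B f)].

Lemma not_good A c : ~ good A -> 0 < c -> G [set f | mu (A `&` B f) < c].
Proof.
move=> nA c0; have [GA|] := in_ultra_setVsetC [set f | c <= mu (A `&` B f)] GU.
  by exfalso; apply: nA; exists c.
by apply: filterS => f /= /negP; rewrite -ltNge.
Qed.

Lemma goodT : good setT.
Proof.
have d0 : 0 < 2 * M + e / 2 by have := M0; have := e0; lra.
exists (e / 2 / (2 * M + e / 2)); first by rewrite divr_gt0// divr_gt0.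
apply: (filterS _ (GP 0)) => f [bf _] /=; rewrite setTI ler_pdivrMr//.
by rewrite [leRHS]mulrC; exact: mu_near_mean.
Qed.

Lemma good_ex A : good A -> exists2 x, K x & A x.
Proof.
move=> [c c0 /filter_ex[f /= cf]].
by have [x Kx [Ax _]] := mu_gt0_ex (lt_le_trans c0 cf); exists x.
Qed.

(* Otherwise a subset [D] of [A] that is not good and of nearly maximal mean could be enlarged by some [A `&` B f]. *)
Lemma good_step A : good A -> G [set f | good (A `&` B f)].
Proof.
move=> [c c0 Gc]; apply: contrapT => nG.
have {nG}nG : G [set f | ~ good (A `&` B f)].
  by have [|] := in_ultra_setVsetC [set f | good (A `&` B f)] GU.
pose E := [set mu D | D in [set D | D `<=` A /\ ~ good D]].
have supE : has_sup E.
  split; last by exists 1 => _ [D _ <-]; exact: mu_le1.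
  exists (mu set0), set0; split => //.
  by move=> /good_ex[].
have c2 : 0 < c / 2 by lra.
(* [D] is within [c / 2] of the supremum. Adding the part of [A] in a suitable [B f] contributes at
   least [c] and overlaps [D] in less than [c / 2], so the mean passes the supremum. *)
have [_ [D [DA nD] <-] Dsup] := sup_adherent c2 supE.
have [f [[/= cf nAf] Df]] := filter_ex (filterI (filterI Gc nG) (not_good nD c2)).
pose D' := D `|` (A `&` B f).
have ED' : E (mu D').
  exists D' => //; split; first by move=> x [/DA//|[]].
  (* A union of two sets that are not good is not good: on most [B g] each has mean below
     [c' / 2]. *)
  move=> [c' c'0 Gc']; have c'2 : 0 < c' / 2 by lra.
  have [g [[/= g1 g2] g3]] := filter_ex (filterI (filterI Gc' (not_good nD c'2))
    (not_good nAf c'2)).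
  have := muUI (D `&` B g) (A `&` B f `&` B g); rewrite -setIUl.
  have := mu_ge0 (D `&` B g `&` (A `&` B f `&` B g)).
  by move: g1 g2 g3; rewrite /D'; lra.
have := sup_upper_bound supE ED'.
have := muUI D (A `&` B f).
have : mu (D `&` (A `&` B f)) <= mu (D `&` B f).
  by apply: le_mu => x [[Dx [_ Bx]] _].
by rewrite -/D'; move: cf Df Dsup; lra.
Qed.

(** The state is the current good set, which is the intersection of the [B (f i)] so far, with the
    list of points so far. The next functional separates those points from the mean and keeps the
    set good; the next point is taken in the shrunken set. *)
Lemma selection_sequences : exists (f : nat -> V -> R) (x : nat -> V),
  [/\ forall k, bounded_functional (f k) 1, forall k, K (x k),
      forall i j, (i <= j)%N -> I (f i) - e / 2 <= f i (x j)
    & forall j k, (j < k)%N -> e < I (f k) - f k (x j)].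
Proof.
have fin (S : seq V) : G [set f | bounded_functional f 1 /\
    forall y, y \in S -> e < I f - f y].
  elim: S => [|y S IH]; first by apply: (filterS _ (GP 0)) => f [].
  apply: (filterS _ (filterI IH (GP y))) => f [[bf fS] [_ fy]]; split => // z.
  by rewrite inE => /predU1P[->|/fS].
have [|h hP] := @choice (set V * seq V)%type ((V -> R) * V)%type
  (fun st p => good st.1 -> [/\ bounded_functional p.1 1, K p.2, (st.1 `&` B p.1) p.2,
     good (st.1 `&` B p.1) & forall y, y \in st.2 -> e < I p.1 - p.1 y]).
  move=> [A S]; have [gA|ngA] := pselect (good A); last by exists (fun=> 0, 0).
  have [f [[bf fS] gf]] := filter_ex (filterI (fin S) (good_step gA)).
  by have [x Kx Ax] := good_ex gf; exists (f, x).
pose st := fix st k := if k is k'.+1 then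
  ((st k').1 `&` B (h (st k')).1, (h (st k')).2 :: (st k').2) else (setT, [::]).
have gst k : good (st k).1.
  by elim: k => [|k IH] /=; [exact: goodT|have [] := hP _ IH].
have stB i j : (i < j)%N -> (st j).1 `<=` B (h (st i)).1.
  elim: j => // j IH; rewrite ltnS leq_eqVlt => /predU1P[->|ij] x [] //.
  by move=> xj _; exact: IH.
have stS j k : (j < k)%N -> (h (st j)).2 \in (st k).2.
  elim: k => // k IH; rewrite ltnS leq_eqVlt /= inE => /predU1P[->|/IH ->].
    by rewrite eqxx.
  by rewrite orbT.
exists (fun k => (h (st k)).1), (fun k => (h (st k)).2); split=> [k|k|i j|j k jk].
- by have [] := hP _ (gst k).
- by have [] := hP _ (gst k).
- have [_ _ [xj Bj] _ _] := hP _ (gst j).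
  by rewrite leq_eqVlt => /predU1P[->//|/stB]; exact.
- by have [_ _ _ _] := hP _ (gst k); apply; exact: stS.
Qed.

Lemma selection_not_weakly_compact : ~ weakly_compact K.
Proof.
move=> cK; have [f [x [bf Kx fx1 fx2]]] := selection_sequences.
have [W [WU sW]] := ultraFilterLemma (F := \oo) _.
have Wlarge k : W [set j | (k <= j)%N] by apply: sW; exact: nbhs_infty_ge.
have [|p Kp xp] := top_compact_ultra cK (fmap_ultra x WU).
  exact: (@filterS _ W _ _ _ (fun j _ => Kx j) filterT).
(* The points [x j] with [i <= j] satisfy this, and the half-space where it fails is weakly open. *)
have fp i : I (f i) - e / 2 <= f i p.
  rewrite leNgt; apply/negP => fpi.
  have Wi : W [set j | f i (x j) < I (f i) - e / 2].
    apply: (xp (f i @^-1` [set r | r < I (f i) - e / 2])) => //.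
    by apply: weak_open_preimage (bf i) _; exact: open_lt.
  have [j [/= ij]] := filter_ex (filterI (Wlarge i) Wi).
  by rewrite ltNge fx1.
have clp : closure (conv_hull (range x)) p.
  rewrite -weak_closure_convex; last exact: convex_conv_hull.
  apply: (tau_cvg_closure _ xp); apply: (filterS _ (Wlarge 0%N)) => j _ /=.
  by apply: sub_conv_hull; exists j.
(* Some [f k] is at most [I (f k) - e] at [z] and at least [I (f k) - e / 2] at [p]; a distance
   below [e / 4] cannot account for this gap. *)
have [z [xz pz]] : conv_hull (range x) `&` ball p (e / 4) !=set0.
  by apply: clp; apply: nbhsx_ballx; rewrite divr_gt0.
(* Eventual bounds survive convex combinations, and at [x j] the bound starts from index [j.+1]. *)
have [k fz] : exists k, forall i, (k <= i)%N -> f i z <= I (f i) - e.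
  pose Z := [set z | exists k, forall i, (k <= i)%N -> f i z <= I (f i) - e].
  suff : conv_hull (range x) `<=` Z by apply.
  apply: conv_hull_min; last first.
    by move=> _ [j _ <-]; exists j.+1 => i ij; have := fx2 _ _ ij; lra.
  move=> u v t [k ku] [m mv] t0 t1; exists (k + m)%N => i kmi.
  rewrite (lin_functionalD (bf i).1) !(lin_functionalZ (bf i).1).
  have h1 := ku i (leq_trans (leq_addr _ _) kmi).
  have h2 := mv i (leq_trans (leq_addl _ _) kmi).
  have t1' : 0 <= 1 - t by lra.
  by have := ler_wpM2l t1' h1; have := ler_wpM2l t0 h2; lra.
have := fz k (leqnn k); have := fp k.
have := bounded_functional_abs (p - z) (bf k).
rewrite mul1r (lin_functionalB (bf k).1) => h1.
rewrite -ball_normE /= in pz; have := le_lt_trans h1 pz.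
by rewrite ltr_norml => /andP[]; have := e0; lra.
Unshelve. all: by apply: eventually_filter.
Qed.

End KreinSmulian.

(** * Weak relative compactness of convex hulls *)

Section KreinSmulianTheorem.
Variables (R : realType) (V : completeNormedModType R).
Implicit Types K : set V.

(** The mean [I] given by the ultrafilter is within any [e] of an evaluation, else the selection
    contradicts weak compactness. The approximating points are norm Cauchy, and their limit [p]
    represents [I] on the dual, hence is the weak limit of the ultrafilter. *)
Lemma weakly_compact_conv_hull K : weakly_compact K ->
  relatively_tau_compact (@weak_open R V) (conv_hull K).
Proof.
move=> cK U UU UK.
have bK f N : bounded_functional f N -> bounded_on K f.
  exact: weakly_compact_functional_bounded.
have [I [mI If]] := ultra_mean bK UU UK.
have ID f g N M : bounded_functional f N -> bounded_functional g M ->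
    I (fun x => f x + g x) = I f + I g.
  by move=> /bK bf /bK bg; exact: meanD mI _ _ bf bg.
have IZ a f N : bounded_functional f N -> I (fun x => a * f x) = a * I f.
  by move=> /bK bf; exact: meanZ mI _ _ bf.
have [M0 KM0] := weakly_compact_bounded cK.
have KM x : K x -> `|x| <= `|M0| + 1.
  by move=> /KM0; have := ler_norm M0; lra.
have Mp : 0 < `|M0| + 1 by have := normr_ge0 M0; lra.
have near_point (e : R) : 0 < e -> exists x, forall f N, 0 < N ->
    bounded_functional f N -> I f - f x <= e * N.
  move=> e0; apply: contrapT => nx.
  have [|G [GU GP]] := selection_ultrafilter ID IZ (e := e).
    move=> x; apply: contrapT => nf; apply: nx; exists x => f N N0 bf.
    by rewrite leNgt; apply/negP => fN; apply: nf; exists f, N.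
  exact: (selection_not_weakly_compact mI KM Mp e0 GU GP) cK.
have en0 n : 0 < n.+1%:R^-1 :> R by rewrite invr_gt0.
have [x xP] := choice (fun n => near_point _ (en0 n)).
(* A norming functional of the difference is tested at [x m] and its opposite at [x n]. *)
have xd n m : `|x n - x m| <= n.+1%:R^-1 + m.+1%:R^-1.
  have [f [bf <-]] := norming_functional (x n - x m).
  rewrite (lin_functionalB bf.1).
  have := xP m f 1 ltr01 bf; have := xP n _ 1 ltr01 (bounded_functionalN bf).
  have -> : I (fun x => - f x) = - I f.
    rewrite -mulN1r -(IZ _ _ _ bf); congr I; apply/funext => y; exact: esym (mulN1r _).
  by rewrite !mulr1; move: (n.+1%:R^-1) (m.+1%:R^-1) => q r; lra.
have inv_small (e : R) : 0 < e -> exists m, forall n, (m <= n)%N -> n.+1%:R^-1 < e.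
  move=> e0; exists (Num.bound e^-1) => n mn.
  have einv : 0 <= e^-1 by rewrite invr_ge0 ltW.
  rewrite -[e]invrK ltf_pV2 ?posrE ?invr_gt0//.
  by apply: lt_le_trans (archi_boundP einv) _; rewrite ler_nat ltnW.
have /cauchy_cvg /cvg_ex[p xp] : cauchy (x @ \oo).
  apply: cauchy_exP => e e0.
  have [|m mP] := inv_small (e / 2); first by rewrite divr_gt0.
  exists (x m); exists m => // n /= mn; rewrite -ball_normE /=.
  by apply: le_lt_trans (xd m n) _; rewrite [e]splitr ltrD// mP.
have IE f N : bounded_functional f N -> I f = f p.
  suff le g L : bounded_functional g L -> I g <= g p.
    move=> bf; apply/le_anti; rewrite (le _ _ bf) /=.
    have := le _ _ (bounded_functionalN bf); rewrite lerNr.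
    have -> : I (fun x => - f x) = - I f; last by rewrite opprK.
    by rewrite -mulN1r -(IZ _ _ _ bf); congr I; apply/funext => y; exact: esym (mulN1r _).
  move=> [lg gL]; pose N' := `|L| + 1.
  have N'0 : 0 < N' by have := normr_ge0 L; rewrite /N'; lra.
  have bg : bounded_functional g N'.
    split => // y; apply: le_trans (gL y) _; apply: ler_wpM2r => //.
    by have := ler_norm L; rewrite /N'; lra.
  apply/ler_addgt0Pr => e e0.
  have d0 : 0 < e / 2 / N' by rewrite !divr_gt0.
  have [m mP] := inv_small _ d0.
  have /cvgrPdist_lt /(_ _ d0) [k _ kP] := xp.
  have h1 := xP (m + k)%N g N' N'0 bg.
  have h2 := bounded_functional_abs (p - x (m + k)%N) bg.
  rewrite (lin_functionalB lg) ler_norml in h2; case/andP: h2 => h2 _.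
  have h3 : (m + k).+1%:R^-1 * N' < e / 2.
    by rewrite -ltr_pdivlMr//; apply: mP; exact: leq_addr.
  have h4 : N' * `|p - x (m + k)%N| < e / 2.
    by rewrite mulrC -ltr_pdivlMr//; apply: kP => /=; exact: leq_addl.
  by have := le_lt_trans h1 h3; clear h1 h3; lra.
exists p => W oW Wp; have [n [fs [e [e0 fsP eW]]]] := oW _ Wp.
apply: (filterS eW); apply: (@filter_forall _ _ (fun i y => `|fs i y - fs i p| < e)) => i.
have [lf cf] := fsP i; have [N bf] := continuous_bounded_functional lf cf.
have := If _ _ bf; rewrite (IE _ _ bf) => /cvgrPdist_lt /(_ e e0).
by apply: filterS => y; rewrite distrC.
Qed.

End KreinSmulianTheorem.

(** * Order extreme points in Banach lattices *)

Section BanachLatticeTopology.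
Variables (R : realType) (V : completeNormedModType R) (le : V -> V -> Prop).
Hypothesis HB : banach_lattice le.
Let HL : riesz_space le := HB.1.
Implicit Types (x y : V) (K : set V).

Lemma vabs_id x : le 0 x -> vabs le x = x.
Proof.
move=> x0; apply: (is_lub2_unique HL (vsupP HL x (- x))).
split; first exact: riesz_refl.
split => //; apply: (riesz_trans HL _ x0).
by have := rieszN HL x0; rewrite oppr0.
Qed.

Lemma vabs_idem x : vabs le (vabs le x) = vabs le x.
Proof. by apply: vabs_id; exact: vabs_ge0. Qed.

Lemma vabs_sub_le x y : le (vabs le x - vabs le y) (vabs le (x - y)).
Proof.
apply/(riesz_sub HL); rewrite opprB addrA; apply/(riesz_sub HL).
apply: (vabs_le HL).
  rewrite -[x in le x _](subrK y); apply: (rieszD HL); exact: le_vabs.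
rewrite -[x in le (- x) _](subrK y) opprD; apply: (rieszD HL); exact: leN_vabs.
Qed.

(** By [vabs_sub_le] and monotonicity of the lattice norm, [vabs] is nonexpansive. *)
Lemma vabs_continuous : continuous (vabs le).
Proof.
move=> x; apply/cvgrPdist_lt => e e0; near=> y.
have xy : `|x - y| < e by near: y; apply: cvgr_dist_lt => //; exact: cvg_id.
apply: le_lt_trans xy; apply: HB.2; apply: (vabs_le HL).
  exact: vabs_sub_le.
rewrite opprB; apply: (riesz_trans HL (vabs_sub_le y x)).
apply: (vabs_le HL); first by rewrite -opprB; exact: leN_vabs.
by rewrite opprB; exact: le_vabs.
Unshelve. all: by end_near. Qed.

(** The positive elements are the fixed points of the continuous map [vabs]. *)
Lemma pos_cone_closed : closed (pos_cone le).
Proof.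
have -> : pos_cone le = (fun x => vabs le x - x) @^-1` [set 0].
  apply/seteqP; split=> x /=; first by move=> /vabs_id ->; rewrite subrr.
  by move=> /eqP; rewrite subr_eq0 => /eqP <-; exact: (vabs_ge0 HL).
apply: closed_comp; last exact: accessible_closed_set1 (hausdorff_accessible (@norm_hausdorff _ V)) _.
by move=> x _; apply: continuousB; [exact: vabs_continuous|exact: cvg_id].
Qed.

Lemma convex_pos_cone : Defs.convex_set (pos_cone le).
Proof.
move=> x y t x0 y0 t0 t1; have t1' : 0 <= 1 - t by lra.
have := rieszD HL (rieszZ HL t1' x0) (rieszZ HL t0 y0).
by rewrite !scaler0 addr0.
Qed.

(** A solid set contains [x] exactly when it contains [vabs le x]. *)
Lemma sch_abs_set K : sch le (abs_set le K) = sch le K.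
Proof.
apply/seteqP; split=> x Kx C cC sC KC; apply: Kx => //.
  move=> _ [y Ky <-]; apply: (sC _ y); first exact: KC.
  by rewrite vabs_idem; exact: riesz_refl.
move=> y Ky; apply: (sC _ (vabs le y)); first by apply: KC; exists y.
by rewrite vabs_idem; exact: riesz_refl.
Qed.

(** The general result applies to the weak topology: the positive cone is convex and norm closed,
    hence weakly closed, and the norm and weak closures of the convex set [sch le K] agree. *)
Lemma oep_sch_weakly_compact K : K `<=` pos_cone le -> weakly_compact K ->
  oep le (closure (sch le K)) `<=` K.
Proof.
move=> Kpos cK; rewrite -(weak_closure_convex (@convex_sch R V le K)).
apply: (oep_tau_sch HL (weak_lc_hausdorff V)) => //.
  exact: closed_convex_weakly_closed convex_pos_cone pos_cone_closed.
exact: weakly_compact_conv_hull.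
Qed.

End BanachLatticeTopology.

Unset Implicit Arguments.

Theorem mainTheorem9 (R : realType) (V : completeNormedModType R)
  (le : V -> V -> Prop) (tau : set (set V)) :
  banach_lattice le -> sufficiently_rich le tau ->
  [/\ (forall K : set V, K `<=` pos_cone le -> top_compact tau K ->
         top_compact tau (top_closure tau (conv_hull K)) ->
         oep le (top_closure tau (sch le K)) `<=` K),
      (forall K : set V, K `<=` pos_cone le -> weakly_compact K ->
         oep le (closure (sch le K)) `<=` K)
    & (forall K : set V, compact K ->
         oep le (closure (sch le K)) `<=` abs_set le K)].
Proof.
move=> HB [Htau _ clpos]; have HL := HB.1; split.
- move=> K Kpos cK cclK; apply: (oep_tau_sch HL Htau) => // G GU GK.
  have [|x _ Gx] := top_compact_ultra cclK GU; last by exists x.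
  by apply: (filterS _ GK) => x Kx U oU Ux; exists x.
- by move=> K; exact: oep_sch_weakly_compact.
- move=> K cK; rewrite -(sch_abs_set HB); apply: (oep_sch_weakly_compact HB).
    by move=> _ [x _ <-]; exact: (vabs_ge0 HL).
  apply: compact_top_compact; first exact: weak_open_open.
  apply: continuous_compact => //.
  by apply: continuous_subspaceT; exact: vabs_continuous.
Qed.
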